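(* Let $\varepsilon\in(0,1]$, $0<\mathrm{Bo}<1$, and let $\zeta_0\in\mathbb{A}^0_0$ be a real-valued zero-mean function with $$|\zeta_0|_{0,0}<\frac{\frac{1}{\mathrm{Bo}}-1}{8\varepsilon\left(\frac{1}{\mathrm{Bo}}+1\right)}.$$ Then there exists a global weak solution $\zeta$ of the thin film equation $$\partial_t\zeta+\partial_x\left((1+\varepsilon\zeta)(\partial_x\zeta+\tfrac{1}{\mathrm{Bo}}\partial_x^3\zeta)\right)=0$$ with initial datum $\zeta_0$ (a weak solution on $[0,T]$ for every $T>0$), which becomes instantaneously analytic in a growing strip of the complex plane. More precisely, for every $\nu\in\left[0,\tfrac12(\tfrac{1}{\mathrm{Bo}}-1)\right)$ and every $T>0$, $\zeta\in L^\infty([0,T];\mathbb{A}^0_{\nu t})\cap L^1([0,T];\mathbb{A}^4_{\nu t})$, and for all $t\in[0,T]$, $$|\zeta(t)|_{0,\nu t}+\tfrac{1}{64}\left(\tfrac{1}{\mathrm{Bo}}-1\right)\int_0^t|\zeta(t')|_{4,\nu t'}\,dt'\leq |\zeta_0|_{0,0},\qquad |\zeta(t)|_{0,\nu t}\leq |\zeta_0|_{0,0}\,e^{-\frac{t}{64}\left(\frac{1}{\mathrm{Bo}}-1\right)}.$$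
   Context: Let $\mathbb{T}=\mathbb{R}/2\pi\mathbb{Z}$. For $f\in L^1(\mathbb{T})$, $\widehat f(n)=\frac{1}{2\pi}\int_{\mathbb{T}}f(x)e^{-inx}\,dx$. For $s,\lambda\geq 0$ the Wiener space $\mathbb{A}^s_\lambda$ is the space of $f\in L^1(\mathbb{T})$ with finite norm $|f|_{s,\lambda}:=\sum_{n\in\mathbb{Z}}(1+|n|)^s e^{\lambda|n|}|\widehat f(n)|$. The statement $\zeta\in L^\infty([0,T];\mathbb{A}^0_{\nu t})\cap L^1([0,T];\mathbb{A}^4_{\nu t})$ means $\sup_{t\in[0,T]}|\zeta(t)|_{0,\nu t}<\infty$ and $\int_0^T|\zeta(t)|_{4,\nu t}dt<\infty$. Weak solution: $\zeta\in L^\infty([0,T],L^\infty(\mathbb{T}))\cap L^1([0,T],W^{3,\infty}(\mathbb{T}))$ is a weak solution with initial datum $\zeta_0\in L^\infty(\mathbb{T})$ if for every $\varphi\in C^\infty([0,T]\times\mathbb{T})$ and $t\in[0,T]$, $$\int_{\mathbb{T}}\zeta(t)\varphi(t)\,dx-\int_{\mathbb{T}}\zeta_0\varphi(0)\,dx-\int_0^t\!\!\int_{\mathbb{T}}\zeta\,\partial_t\varphi\,dx\,dt'=\int_0^t\!\!\int_{\mathbb{T}}(1+\varepsilon\zeta)\partial_x\zeta\,\partial_x\varphi\,dx\,dt'+\frac{1}{\mathrm{Bo}}\int_0^t\!\!\int_{\mathbb{T}}(1+\varepsilon\zeta)\partial_x^3\zeta\,\partial_x\varphi\,dx\,dt'.$$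 *)

(* Defs.v *)
From HB Require Import structures.
From mathcomp Require Import all_boot all_order all_algebra.
From mathcomp Require Import all_classical all_reals all_analysis.
Set Implicit Arguments. Unset Strict Implicit. Unset Printing Implicit Defensive.
Import Order.TTheory GRing.Theory Num.Theory.
Import numFieldNormedType.Exports.
Local Open Scope classical_set_scope.
Local Open Scope ring_scope.

Section ThinFilm.
Variable R : realType.
Local Notation mu := (@lebesgue_measure R).

(* The torus T = R / 2piZ: functions on T are represented by functions R -> R,
   integrals over T are integrals over one period [0, 2pi]. *)
Definition torus : set R := `[0%R, 2 * pi]%classic.

Definition intT (f : R -> R) : R := (\int[mu]_(x in torus) f x)%R.

Definition L1T (f : R -> R) : Prop :=
  mu.-integrable torus (fun x => (f x)%:E).

(* Fourier coefficient  \hat f(n) = 1/(2pi) \int_T f(x) e^{-inx} dx  of a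
   real-valued f, written via its real and imaginary parts. *)
Definition fourier_re (f : R -> R) (n : int) : R :=
  (2 * pi)^-1 * intT (fun x => f x * cos (n%:~R * x)).
Definition fourier_im (f : R -> R) (n : int) : R :=
  - ((2 * pi)^-1 * intT (fun x => f x * sin (n%:~R * x))).
Definition fourier_abs (f : R -> R) (n : int) : R :=
  Num.sqrt (fourier_re f n ^+ 2 + fourier_im f n ^+ 2).

Definition wnorm (s lam : R) (f : R -> R) : \bar R :=
  (\esum_(n in [set: int]) ((1 + `|n%:~R|) `^ s * expR (lam * `|n%:~R|)
                             * fourier_abs f n)%:E)%E.

Definition wiener (s lam : R) (f : R -> R) : Prop :=
  L1T f /\ (wnorm s lam f < +oo)%E.

Definition jmeas (z : R -> R -> R) : Prop :=
  measurable_fun [set: R * R] (fun p : R * R => z p.1 p.2).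

Fixpoint pder (l : seq bool) (phi : R -> R -> R) : R -> R -> R :=
  match l with
  | [::] => phi
  | b :: l' => let psi := pder l' phi in
      if b then (fun t x => derive1 (fun s => psi s x) t)
      else (fun t x => derive1 (psi t) x)
  end.

(* phi in C^infty(R^2): all iterated partial derivatives exist and are
   continuous; and 2pi-periodic in x.  (Test functions in C^infty([0,T] x T).) *)
Definition test_fun (phi : R -> R -> R) : Prop :=
  (forall l : seq bool,
     continuous (fun p : R * R => pder l phi p.1 p.2) /\
     (forall t x, derivable (fun s => pder l phi s x) t 1 /\
                  derivable (pder l phi t) x 1)) /\
  (forall t x, phi t (x + 2 * pi) = phi t x).

Definition test_fun1 (psi : R -> R) : Prop :=
  (forall (n : nat) x, derivable (iter n (@derive1 R R) psi) x 1) /\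
  (forall x, psi (x + 2 * pi) = psi x).

Definition dx (phi : R -> R -> R) := pder [:: false] phi.
Definition dt (phi : R -> R -> R) := pder [:: true] phi.

(* Weak solution on [0,T] with initial datum zeta0, following the paper:
   zeta in L^infty([0,T], L^infty(T)) cap L^1([0,T], W^{3,infty}(T)), where
   D1, D2, D3 are the weak x-derivatives of zeta(t), and the integral
   identity holds for every test function and every t in [0,T]. *)
Definition weak_solution (eps Bo T : R) (zeta0 : R -> R)
    (zeta : R -> R -> R) : Prop :=
  jmeas zeta /\
  (exists M : R, {ae mu, forall t, t \in `[0%R, T] ->
      {ae mu, forall x, x \in torus -> `|zeta t x| <= M}}) /\
  exists D1 D2 D3 : R -> R -> R,
    [/\ jmeas D1, jmeas D2 & jmeas D3] /\
    {ae mu, forall t, t \in `[0%R, T] ->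
      forall psi, test_fun1 psi ->
       [/\ intT (fun x => zeta t x * derive1 psi x)
             = - intT (fun x => D1 t x * psi x),
           intT (fun x => zeta t x * iter 2 (@derive1 R R) psi x)
             = intT (fun x => D2 t x * psi x) &
           intT (fun x => zeta t x * iter 3 (@derive1 R R) psi x)
             = - intT (fun x => D3 t x * psi x)]} /\
    (* t |-> |zeta(t)|_{W^{3,infty}} is integrable on [0,T] *)
    (exists g : R -> R, mu.-integrable `[0%R, T] (fun t => (g t)%:E) /\
      {ae mu, forall t, t \in `[0%R, T] ->
        {ae mu, forall x, x \in torus ->
          `|zeta t x| + `|D1 t x| + `|D2 t x| + `|D3 t x| <= g t}}) /\
    forall phi, test_fun phi -> forall t, t \in `[0%R, T] ->
      intT (fun x => zeta t x * phi t x) - intT (fun x => zeta0 x * phi 0 x)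
      - (\int[mu]_(s in `[0%R, t]) intT (fun x => zeta s x * dt phi s x))
      = (\int[mu]_(s in `[0%R, t])
           intT (fun x => (1 + eps * zeta s x) * D1 s x * dx phi s x))
        + Bo^-1 * (\int[mu]_(s in `[0%R, t])
           intT (fun x => (1 + eps * zeta s x) * D3 s x * dx phi s x)).

End ThinFilm.

(* Main.v *)
(** Put [beta = 1/Bo].  The mode [n] of the solution obeys
    [u_n' = (n^2 - beta n^4) u_n + eps n sum_m (m - beta m^3) u_(n-m) u_m].
    Expanding in the initial modes writes the solution as a sum over binary trees
    of waves [a_T(t) cos (n_T x + theta_T)], where the amplitude of a node solves
    a scalar linear equation forced by the product of the amplitudes of its two
    subtrees.  All amplitudes are nonnegative up to a sign constant in time, so the
    partial sums of [sum_T e^(nu t |n_T|) |a_T|] increase with the level of the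
    trees.  If level [k] has [b_k <= z0], with [z0] the norm of the initial datum,
    the interpolation [a b^3 + a^3 b <= a^4 + b^4] gives
    [b_(k+1) + (beta - 1)/2 int a4_(k+1) <= z0 + (beta - 1)/4 int a4_k]
    under the smallness condition, and [a4_k <= a4_(k+1)] closes the induction:
    neither a contraction nor a compactness argument is needed.  The weight
    [e^(ct)] is carried along in the same way and yields the decay.  At each level
    the sums solve the equation exactly with the nonlinearity taken one level below,
    and dominated convergence gives the weak formulation. *)

(* Dissipation budget. Off the zero mode, [sigma] is at least [(beta - 1) n^4]. Half of it pays for
   the widening strip, hence the range of [nu]; a quarter absorbs the quadratic term; the last
   quarter, [gamma], is left for the energy integral or for the decay rate. The 8 in the smallness
   condition comes from the second item: the quadratic term costs [2 eps (beta + 1) z0] and may use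
   [(beta - 1) / 4]. The 64 is 4 times 16, since [(1 + n)^4 <= 16 n^4] for [n >= 1].

   The zero mode is undamped. The divergence form of the equation puts the total frequency in front
   of every coupling, so a zero-mean datum never excites it.

   The delicate point is time zero: the datum has no derivatives, and the differentiated series are
   controlled only for [t > 0]. What survives is a majorant in time, integrable up to 0 though
   possibly unbounded there. Moreover the expansion sees the datum only through its Fourier
   coefficients; putting the datum itself back into the weak identity needs a uniqueness theorem for
   the coefficients of an integrable function, obtained here with an explicit kernel. *)
Require Import Defs.
From HB Require Import structures.
From mathcomp Require Import all_boot all_order all_algebra.
From mathcomp Require Import all_classical all_reals all_analysis.
From mathcomp Require Import measurable_realfun ring lra.
Set Implicit Arguments. Unset Strict Implicit. Unset Printing Implicit Defensive.
Import Order.TTheory GRing.Theory Num.Theory.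
Import numFieldNormedType.Exports.
Local Open Scope classical_set_scope.
Local Open Scope ring_scope.

(** * Calculus on the line *)

Section calculus.
Context {R : realType}.
Local Notation mu := (@lebesgue_measure R).
Implicit Types f g h : R -> R.

Lemma continuous_itv_integrable f (a b : R) : continuous f ->
  mu.-integrable `[a, b] (EFin \o f).
Proof.
move=> cf; apply: continuous_compact_integrable; first exact: segment_compact.
exact: continuous_subspaceT.
Qed.

(* The second integral makes [prim f] a primitive of [f] on the whole line, so that
   amplitudes are differentiable for all real times. *)
Definition prim f (t : R) : R :=
  \int[mu]_(s in `[0%R, t]) f s - \int[mu]_(s in `[t, 0%R]) f s.

Lemma prim_ge f (t : R) : 0 <= t -> prim f t = \int[mu]_(s in `[0%R, t]) f s.
Proof.
rewrite /prim le_eqVlt => /predU1P[<-|t0].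
  by rewrite set_itv1 Rintegral_set1 subr0.
by rewrite [in X in _ - X]set_itv_ge ?bnd_simp -?ltNge// Rintegral_set0 subr0.
Qed.

Lemma prim0 f : prim f 0 = 0.
Proof. by rewrite prim_ge// set_itv1 Rintegral_set1. Qed.

(** Rebasing at a point left of both 0 and [t] replaces the two signed integrals by one integral
    from a fixed endpoint, the form that the fundamental theorem accepts. *)
Lemma prim_shift f (a t : R) : continuous f -> a <= 0 -> a <= t ->
  prim f t = \int[mu]_(s in `[a, t]) f s - \int[mu]_(s in `[a, 0%R]) f s.
Proof.
move=> cf a0 at_; case: (leP 0 t) => t0.
  rewrite prim_ge// Rintegral_itvB ?bnd_simp//; last exact: continuous_itv_integrable.
  rewrite Rintegral_itv_obnd_cbnd//.
  by apply: integrableS (continuous_itv_integrable 0 t cf) => //; apply: subset_itv_oc_cc.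
rewrite /prim set_itv_ge ?bnd_simp -?ltNge// Rintegral_set0 sub0r.
rewrite -[RHS]opprB Rintegral_itvB ?bnd_simp// ?ltW//; last exact: continuous_itv_integrable.
rewrite Rintegral_itv_obnd_cbnd//.
by apply: integrableS (continuous_itv_integrable t 0 cf) => //; apply: subset_itv_oc_cc.
Qed.

Lemma is_derive_prim f (t : R) : continuous f -> is_derive t 1 (prim f) (f t).
Proof.
(* This base point is strictly left of [t] and of 0, so near [t] the function [prim f] is the
   integral from [a] up to a constant. *)
move=> cf; pose a := Num.min t 0 - 1.
have at_ : a < t by rewrite /a; have := ge_min t t 0; rewrite lexx /= => h; lra.
have a0 : a <= 0 by rewrite /a; have := ge_min 0 t 0; rewrite lexx orbT => h; lra.
have [dF F'] := @continuous_FTC1_closed R f a t (t + 1) ltac:(lra)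
  (continuous_itv_integrable _ _ cf) at_ (cf t).
set F := (fun x : R => _) in dF F'.
apply: (@near_eq_is_derive _ _ _ (F - cst (\int[mu]_(s in `[a, 0%R]) f s))).
- near=> s; rewrite /= (@prim_shift f a) //.
  by apply: ltW; near: s; exact: lt_nbhsr.
- rewrite -[f t]subr0; apply: is_deriveB.
  by rewrite -F'; rewrite derive1E; exact: derivableP.
Unshelve. all: by end_near. Qed.

Lemma is_derive_continuous f (df : R -> R) : (forall t : R, is_derive t 1 f (df t)) -> continuous f.
Proof. by move=> d t; apply: differentiable_continuous; apply/derivable1_diffP. Qed.

(** Comparison principle behind every estimate in time. Time integrals are put inside [f] and [g] as
    primitives, so no Gronwall factor appears. *)
Lemma le_derive f g (df dg : R -> R) (t : R) : 0 <= t ->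
  (forall s : R, is_derive s 1 f (df s)) -> (forall s : R, is_derive s 1 g (dg s)) ->
  f 0 <= g 0 -> (forall s, 0 <= s -> df s <= dg s) -> f t <= g t.
Proof.
move=> t0 f' g' fg0 dfg.
have h (s : R) : is_derive s 1 (g - f) (dg s - df s) by exact: is_deriveB.
have : (g - f) 0 <= (g - f) t.
  apply: (@ger0_derive1_le_cc R (g - f) 0 t) => //.
  - move=> s; rewrite in_itv /= => /andP[s0 _].
    by rewrite derive1E derive_val subr_ge0; exact/dfg/ltW.
  - by apply: continuous_subspaceT; exact: is_derive_continuous.
  - by rewrite in_itv /= lexx.
  - by rewrite in_itv /= lexx andbT.
by rewrite /= !fctE; lra.
Qed.

End calculus.

(** * Integrals over the torus *)

Section integrals.
Context {R : realType}.
Local Notation mu := (@lebesgue_measure R).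
Local Notation torus := (@torus R).
Implicit Types f g h : R -> R.

(** The single point [p] is a null set where convergence and domination may fail; a [p] outside [D]
    excepts nothing. *)
Lemma Rintegral_dominated_cvg (D : set R) (p : R) (f_ : nat -> R -> R) f g :
  measurable D -> (forall n, measurable_fun D (f_ n)) -> measurable_fun D f ->
  (forall x, D x -> x != p -> f_ ^~ x @ \oo --> f x) ->
  mu.-integrable D (EFin \o g) ->
  (forall n x, D x -> x != p -> `|f_ n x| <= g x) ->
  mu.-integrable D (EFin \o f) /\
  (fun n => \int[mu]_(x in D) f_ n x) @ \oo --> \int[mu]_(x in D) f x.
Proof.
move=> mD mf_ mf f_f ig f_g.
have aeS (P : R -> Prop) : (forall x, x != p -> P x) -> {ae mu, forall x, P x}.
  move=> h; exists [set p]; split => //; first exact: lebesgue_measure_set1.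
  move=> x /= nh; apply: contrapT => xp; apply: nh; apply: h; exact/eqP.
have [] := @dominated_convergence _ _ _ mu D mD (fun n => EFin \o f_ n)
  (EFin \o f) (EFin \o g) _ _ _ ig _.
- by move=> n; apply/measurable_EFinP; exact: mf_.
- by apply/measurable_EFinP; exact: mf.
- apply: aeS => x xp Dx; apply: cvg_EFin; last exact: f_f.
  by apply: nearW.
- by apply: aeS => x xp n Dx; rewrite lee_fin; exact: f_g.
move=> intf _ cf; split => //.
have fin : (\int[mu]_(x in D) (f x)%:E)%E \is a fin_num.
  exact: (@integrable_fin_num _ _ _ mu D mD _ intf).
move: cf; rewrite -(fineK fin) => /fine_cvgP[_]; exact.
Qed.

Lemma continuous_section1 (F : R -> R -> R) (x : R) :
  continuous (fun p : R * R => F p.1 p.2) -> continuous (F ^~ x).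
Proof.
move=> cF s; apply: (@continuous2_cvg _ _ _ _ _ _ id (cst x) F s x).
- exact: (cF (s, x)).
- exact: cvg_id.
- exact: cvg_cst.
Qed.

Lemma continuous_section2 (F : R -> R -> R) (s : R) :
  continuous (fun p : R * R => F p.1 p.2) -> continuous (F s).
Proof.
move=> cF x; apply: (@continuous2_cvg _ _ _ _ _ _ (cst s) id F s x).
- exact: (cF (s, x)).
- exact: cvg_cst.
- exact: cvg_id.
Qed.

(** Source of the dominating constants, both for differentiating under the integral and for the test
    functions in the limit. *)
Lemma continuous_bounded_rectangle (F : R -> R -> R) (a b c d : R) :
  continuous (fun p : R * R => F p.1 p.2) ->
  exists M, 0 <= M /\ forall s x, s \in `[a, b] -> x \in `[c, d] -> `|F s x| <= M.
Proof.
move=> cF.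
have cK : compact (`[a, b] `*` `[c, d] : set (R * R)).
  by apply: compact_setX; exact: segment_compact.
have /compact_bounded[M [_ hM]] :=
  continuous_compact (continuous_subspaceT cF) cK.
exists (`|M| + 1); split; first by rewrite addr_ge0.
move=> s x sab xcd; apply: (hM (`|M| + 1)).
  by rewrite (le_lt_trans (ler_norm M))// ltrDl.
by exists (s, x).
Qed.

Lemma measurable_torus : measurable torus.
Proof. exact: measurable_itv. Qed.

Lemma continuous_L1T f : continuous f -> L1T f.
Proof. exact: continuous_itv_integrable. Qed.

Lemma torus_cst_integrable (M : R) : mu.-integrable torus (EFin \o cst M).
Proof. by apply: continuous_L1T => x; exact: cvg_cst. Qed.

Lemma continuous_intT (F : R -> R -> R) :
  continuous (fun p : R * R => F p.1 p.2) -> continuous (fun s => intT (F s)).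
Proof.
move=> cF s.
have [M [M0 hM]] := continuous_bounded_rectangle (s - 1) (s + 1) 0 (2 * pi) cF.
have I z : `]s - 1, s + 1[%classic z -> z \in `[s - 1, s + 1].
  by rewrite /= !in_itv /= => /andP[/ltW-> /ltW->].
apply: (@continuity_under_integral R _ _ mu F torus measurable_torus (s - 1) (s + 1)
  _ _ (cst M)).
- by move=> x _; apply: continuous_L1T; exact: continuous_section2.
- by apply: aeW => y _ z _; exact: continuous_section1.
- exact: torus_cst_integrable.
- by move=> x /I Ix; apply: aeW => y yT; exact: hM.
- by rewrite inE /= in_itv /=; lra.
Qed.

Lemma is_derive_intT (F dF : R -> R -> R) (s : R) :
  continuous (fun p : R * R => F p.1 p.2) ->
  continuous (fun p : R * R => dF p.1 p.2) ->
  (forall s x : R, is_derive s 1 (F ^~ x) (dF s x)) ->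
  is_derive s 1 (fun s => intT (F s)) (intT (dF s)).
Proof.
move=> cF cdF dFE.
have E s' x : derive1 (F ^~ x) s' = dF s' x by rewrite derive1E derive_val.
have [M [M0 hM]] := continuous_bounded_rectangle (s - 1) (s + 1) 0 (2 * pi) cdF.
have I z : `]s - 1, s + 1[%classic z -> z \in `[s - 1, s + 1].
  by rewrite /= !in_itv /= => /andP[/ltW-> /ltW->].
have Is : `]s - 1, s + 1[%classic s by rewrite /= in_itv /=; lra.
have H1 z : `]s - 1, s + 1[%classic z -> mu.-integrable torus (EFin \o F z).
  by move=> _; apply: continuous_L1T; exact: continuous_section2.
have H2 z y : `]s - 1, s + 1[%classic z -> torus y -> derivable (F ^~ y) z 1.
  by move=> _ _; exact: ex_derive.
have H3 z y : `]s - 1, s + 1[%classic z -> torus y ->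
    `|partial1of2 F z y| <= cst M y.
  by move=> /I Iz yT; rewrite /partial1of2 E; exact: hM.
apply: DeriveDef.
  exact: (@derivable_under_integral R _ _ mu F torus measurable_torus s _ _ Is H1 H2
    (cst M) (fun=> M0) (torus_cst_integrable M) H3).
rewrite -derive1E.
have -> := (@differentiation_under_integral R _ _ mu F torus measurable_torus s _ _ Is H1 H2
    (cst M) (fun=> M0) (torus_cst_integrable M) H3).
by apply: eq_Rintegral => y _; rewrite /partial1of2 E.
Qed.

Lemma Rintegral_Fubini (A B : set R) (F : R -> R -> R) g :
  measurable A -> measurable B -> (mu B < +oo)%E ->
  jmeas F -> mu.-integrable A (EFin \o g) ->
  (forall x y, A x -> B y -> `|F x y| <= g x) ->
  \int[mu]_(x in A) \int[mu]_(y in B) F x y =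
  \int[mu]_(y in B) \int[mu]_(x in A) F x y.
Proof.
move=> mA mB muB mF ig Fg.
(* Extension by zero off [A] times [B], so that Fubini's theorem applies on the whole plane. *)
pose f (p : measurableTypeR R * measurableTypeR R) : \bar R :=
  (F p.1 p.2 * (\1_A p.1 * \1_B p.2))%:E.
have mf : measurable_fun setT f.
  apply/measurable_EFinP; apply: measurable_funM; first exact: mF.
  by apply: measurable_funM; apply: measurableT_comp => //; exact: measurable_indic.
have secA x : measurable_fun B (F x).
  by apply: measurable_funTS; exact: (measurableT_comp mF (pair1_measurable x)).
have secB y : measurable_fun A (F ^~ y).
  by apply: measurable_funTS; exact: (measurableT_comp mF (pair2_measurable y)).
have iA x : A x -> mu.-integrable B (EFin \o F x).
  move=> Ax; apply: (@le_integrable _ _ _ mu B mB _ (EFin \o cst (g x))).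
  - by apply/measurable_EFinP; exact: secA.
  - by move=> y By; rewrite lee_fin (le_trans (Fg _ _ Ax By))// ler_norm.
  - apply/integrableP; split; first exact/measurable_EFinP.
    apply: (@le_lt_trans _ _ (\int[mu]_(y in B) cst `|g x|%:E y)%E) => //.
    by rewrite integral_cst// lte_mul_pinfty.
have iB y : B y -> mu.-integrable A (fun x => (F x y)%:E).
  move=> By; apply: (@le_integrable _ _ _ mu A mA _ (EFin \o g)) => //.
  - by apply/measurable_EFinP; exact: secB.
  - by move=> x Ax; rewrite lee_fin (le_trans (Fg _ _ Ax By))// ler_norm.
(* Tonelli's criterion: the inner integral of the modulus is at most [|g x|] times the finite
   measure of [B]. *)
have imf : (mu \x mu)%E.-integrable setT f.
  apply/(integrable12ltyP _ _ mf).
  have mg : @measurable_fun _ _ (measurableTypeR R) _ A (fun x => `|g x|%:E * mu B)%E.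
    under eq_fun do rewrite muleC.
    apply: measurable_funeM; apply/measurable_EFinP; apply: measurableT_comp => //.
    by apply/measurable_EFinP; exact: (measurable_int mu ig).
  apply: (@le_lt_trans _ _ (\int[mu]_x ((fun x => `|g x|%:E * mu B) \_ A) x)%E).
    apply: ge0_le_integral => //.
    - by move=> x _; exact: integral_ge0.
    - apply: (measurable_fun_fubini_tonelli_F (abse \o f)) => /=.
        by apply: (measurableT_comp _ mf).
      by move=> x; rewrite lee_fin.
    - apply/(measurable_restrictT _ mA); exact: mg.
    - move=> x _; rewrite patchE; case: ifPn => [/set_mem Ax|/negP nAx]; last first.
        rewrite integral0_eq// => y _; rewrite /f /= indicE.
        by rewrite (_ : (x \in A) = false) ?mul0r ?mulr0 ?normr0//; exact/negP.
      rewrite -integral_cst// [leRHS]integral_mkcond.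
      apply: ge0_le_integral => //.
      - by apply: measurableT_comp => //; exact: (measurableT_comp mf).
      - apply/(measurable_restrictT _ mB); exact: measurable_cst.
      - move=> y _; rewrite /f patchE /= !indicE (mem_set Ax) mul1r.
        case: ifPn => [/set_mem By|_]; last by rewrite mulr0 normr0.
        by rewrite mulr1 lee_fin (le_trans (Fg _ _ Ax By))// ler_norm.
  rewrite -integral_mkcond ge0_integralZr//.
  - apply: lte_mul_pinfty => //; first exact: integral_ge0.
    have ig' : mu.-integrable A (fun x => `|g x|%:E) by have := integrable_norm ig; apply.
    exact: (@integrable_fin_num _ _ _ mu A mA _ ig').
  - apply/measurable_EFinP; apply: measurableT_comp => //.
    by apply/measurable_EFinP; exact: (measurable_int mu ig).
have f1 x : (\int[mu]_y f (x, y))%E = ((fun x => (\int[mu]_(y in B) F x y)%:E) \_ A) x.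
  rewrite patchE; case: ifPn => [/set_mem Ax|/negP nAx].
    rewrite [in RHS]/Rintegral fineK; last exact: (@integrable_fin_num _ _ _ mu B mB _ (iA x Ax)).
    rewrite [RHS]integral_mkcond; apply: eq_integral => y _.
    rewrite /f /= patchE indicE (mem_set Ax) mul1r indicE.
    by case: ifPn => _ /=; rewrite ?mulr1// mulr0.
  rewrite integral0_eq// => y _; rewrite /f /= indicE.
  by rewrite (_ : (x \in A) = false) ?mul0r ?mulr0//; exact/negP.
have f2 y : (\int[mu]_x f (x, y))%E = ((fun y => (\int[mu]_(x in A) F x y)%:E) \_ B) y.
  rewrite patchE; case: ifPn => [/set_mem By|/negP nBy].
    rewrite [in RHS]/Rintegral fineK; last exact: (@integrable_fin_num _ _ _ mu A mA _ (iB y By)).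
    rewrite [RHS]integral_mkcond; apply: eq_integral => x _.
    rewrite /f /= patchE [X in (_ * (_ * X))%:E]indicE (mem_set By) mulr1 indicE.
    by case: ifPn => _ /=; rewrite ?mulr1// mulr0.
  rewrite integral0_eq// => x _; rewrite /f /= [X in (_ * (_ * X))%:E]indicE.
  by rewrite (_ : (y \in B) = false) ?mulr0//; exact/negP.
have := @Fubini _ _ _ _ R mu mu f imf.
under eq_integral do rewrite f1.
under [RHS]eq_integral do rewrite f2.
by rewrite -!integral_mkcond /Rintegral => ->.
Qed.

End integrals.

(** * Derivative rules for functions written pointwise *)

Section derivative_rules.
Context {R : realType}.
Implicit Types (f g : R -> R) (x : R).

Lemma isdD f g x (df dg : R) : is_derive x 1 f df -> is_derive x 1 g dg ->
  is_derive x 1 (fun y => f y + g y) (df + dg).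
Proof. by move=> *; exact: is_deriveD. Qed.

Lemma isdM f g x (df dg : R) : is_derive x 1 f df -> is_derive x 1 g dg ->
  is_derive x 1 (fun y => f y * g y) (df * g x + f x * dg).
Proof.
move=> hf hg; have -> : df * g x + f x * dg = f x *: dg + g x *: df.
  by rewrite /GRing.scale /=; ring.
exact: is_deriveM.
Qed.

Lemma isdZ f x (k df : R) : is_derive x 1 f df ->
  is_derive x 1 (fun y => k * f y) (k * df).
Proof. by move=> hf; exact: is_deriveZ. Qed.

Lemma isdC x (k : R) : is_derive x 1 (fun _ : R => k) 0.
Proof. exact: is_derive_cst. Qed.

Lemma isdX f x (df : R) n : is_derive x 1 f df ->
  is_derive x 1 (fun y : R => f y ^+ n) (n%:R * f x ^+ n.-1 * df).
Proof.
move=> hf; have -> : n%:R * f x ^+ n.-1 * df = (n%:R * f x ^+ n.-1) *: df by [].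
by rewrite -exprfctE; exact: is_deriveX.
Qed.

Lemma isd_lin f (x a b df : R) : is_derive (a * x + b) 1 f df ->
  is_derive x 1 (fun y => f (a * y + b)) (a * df).
Proof.
move=> hf.
have hl : is_derive x 1 (fun y => a * y + b) (a * 1 + 0).
  by apply: isdD.
have := @is_derive1_comp _ f (fun y => a * y + b) x _ _ hf hl.
by rewrite mulr1 addr0 mulrC.
Qed.

Lemma isd_sum (I : Type) (r : seq I) (h : I -> R -> R) x (dh : I -> R) :
  (forall i, is_derive x 1 (h i) (dh i)) ->
  is_derive x 1 (fun y => \sum_(i <- r) h i y) (\sum_(i <- r) dh i).
Proof.
move=> hh; elim: r => [|i r ih].
  by rewrite big_nil; under eq_fun do rewrite big_nil; exact: isdC.
by rewrite big_cons; under eq_fun do rewrite big_cons; exact: isdD.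
Qed.

Lemma isd_eq f x (df df' : R) : is_derive x 1 f df -> df = df' -> is_derive x 1 f df'.
Proof. by move=> ? <-. Qed.

End derivative_rules.

(** * Linearity, order and integration by parts over one period *)

Section torus_integrals.
Context {R : realType}.
Local Notation mu := (@lebesgue_measure R).
Local Notation torus := (@torus R).
Implicit Types f g h : R -> R.

Lemma Rintegral_FTC2 F f (a b : R) : a <= b ->
  (forall x : R, is_derive x 1 F (f x)) -> continuous f ->
  \int[mu]_(x in `[a, b]) f x = F b - F a.
Proof.
rewrite le_eqVlt => /predU1P[<-|ab] dF cf.
  by rewrite set_itv1 Rintegral_set1 subrr.
have cF : continuous F by exact: is_derive_continuous.
rewrite /Rintegral (@continuous_FTC2 R f F a b) //.
- exact: continuous_subspaceT.
- split.
  + by move=> x _; exact: ex_derive.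
  + by apply: cvg_at_right_filter; exact: cF.
  + by apply: cvg_at_left_filter; exact: cF.
- by move=> x _; rewrite derive1E derive_val.
Qed.

Lemma L1TM h w : L1T h -> continuous w -> L1T (fun x => h x * w x).
Proof.
move=> hh cw.
have /compact_bounded[M [_ hM]] :=
  continuous_compact (continuous_subspaceT cw) (@segment_compact R 0 (2 * pi)).
have wM x : torus x -> `|w x| <= `|M| + 1.
  move=> xT; apply: (hM (`|M| + 1)); last by exists x.
  by rewrite (le_lt_trans (ler_norm M))// ltrDl.
apply: (@le_integrable _ _ _ mu _ measurable_torus _ (fun x => ((`|M| + 1) * h x)%:E)).
- apply/measurable_EFinP; apply: measurable_funM.
    by apply/measurable_EFinP; exact: (measurable_int mu hh).
  by apply: measurable_funTS; exact: continuous_measurable_fun.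
- move=> x xT; rewrite lee_fin !normrM mulrC ler_wpM2r// (le_trans (wM x xT))//.
  exact: ler_norm.
- by have := @integrableZl _ _ _ mu torus measurable_torus (`|M| + 1) _ hh; apply.
Qed.

Lemma L1TD f g : L1T f -> L1T g -> L1T (fun x => f x + g x).
Proof.
move=> hf hg; have := @integrableD _ _ _ mu torus measurable_torus _ _ hf hg.
by apply.
Qed.

Lemma L1TZ k f : L1T f -> L1T (fun x => k * f x).
Proof.
by move=> hf; have := @integrableZl _ _ _ mu torus measurable_torus k _ hf; apply.
Qed.

Lemma intTD f g : L1T f -> L1T g ->
  intT (fun x => f x + g x) = intT f + intT g.
Proof. by move=> hf hg; exact: (@RintegralD _ _ _ mu torus f g measurable_torus hf hg). Qed.

Lemma intTZ k f : L1T f -> intT (fun x => k * f x) = k * intT f.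
Proof. by move=> hf; exact: (@RintegralZl _ _ _ mu torus f k measurable_torus hf). Qed.

Lemma intTN f : L1T f -> intT (fun x => - f x) = - intT f.
Proof.
move=> hf; rewrite -mulN1r -intTZ//; apply: eq_Rintegral => x _.
by rewrite mulN1r.
Qed.

Lemma intT_le f g : L1T f -> L1T g -> (forall x, x \in torus -> f x <= g x) ->
  intT f <= intT g.
Proof.
move=> hf hg fg; apply: (@le_Rintegral _ _ _ mu torus f g measurable_torus hf hg) => x.
by move=> /mem_set; exact: fg.
Qed.

Lemma intT_norm f : L1T f -> `|intT f| <= intT (fun x => `|f x|).
Proof. by move=> hf; exact: (@le_normr_Rintegral _ _ _ mu torus f measurable_torus hf). Qed.

Lemma intT_cst (k : R) : intT (fun=> k) = k * (2 * pi).
Proof.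
have mT : mu torus = (2 * pi)%:E.
  by rewrite /torus lebesgue_measure_itv /= lte_fin mulr_gt0 ?pi_gt0// -EFinB subr0.
rewrite /intT (@Rintegral_cst _ _ _ mu _ measurable_torus k).
by rewrite [X in fine X]mT.
Qed.

Lemma intT_by_parts F G f g :
  (forall x : R, is_derive x 1 F (f x)) -> (forall x : R, is_derive x 1 G (g x)) ->
  continuous f -> continuous g -> F (2 * pi) * G (2 * pi) = F 0 * G 0 ->
  intT (fun x => F x * g x) = - intT (fun x => f x * G x).
Proof.
move=> dF dG cf cg per.
have cF := is_derive_continuous dF. have cG := is_derive_continuous dG.
have dFG (x : R) : is_derive x 1 (fun x => F x * G x) (f x * G x + F x * g x).
  exact: isdM.
have pi2 : 0 <= 2 * pi :> R by rewrite mulr_ge0 ?pi_ge0.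
apply/eqP; rewrite -addr_eq0 addrC -intTD.
- rewrite /intT (Rintegral_FTC2 pi2 dFG) ?per ?subrr//.
  by move=> x; apply: cvgD; apply: cvgM; [exact: cf|exact: cG|exact: cF|exact: cg].
- by apply: continuous_L1T => x; apply: cvgM; [exact: cf|exact: cG].
- by apply: continuous_L1T => x; apply: cvgM; [exact: cF|exact: cg].
Qed.

End torus_integrals.

(** * Uniqueness of Fourier coefficients *)

Section uniqueness.
Context {R : realType}.
Local Notation mu := (@lebesgue_measure R).
Local Notation torus := (@torus R).
Implicit Types f g h q : R -> R.

Lemma continuous_cosl (a b : R) : continuous (fun x : R => cos (a * x + b)).
Proof.
apply: is_derive_continuous => t; apply: isd_lin.
Qed.

Lemma continuous_sinl (a b : R) : continuous (fun x : R => sin (a * x + b)).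
Proof.
apply: is_derive_continuous => t; apply: isd_lin.
Qed.

(* De la Vallee Poussin's kernel, up to normalisation.  It is a trigonometric
   polynomial, and integrating [(sin u * vp_kernel N u)'] over a period shows that the
   mean of [1 - cos u] against it is [1 / (N + 1)]. *)
Definition vp_kernel (N : nat) (u : R) : R := ((1 + cos u) / 2) ^+ N.

Lemma vp_kernel_ge0 N u : 0 <= vp_kernel N u.
Proof. by rewrite exprn_ge0// divr_ge0// -lerBlDl sub0r cos_geN1. Qed.

Lemma vp_kernel_le1 N u : vp_kernel N u <= 1.
Proof.
apply: exprn_ile1; first by rewrite divr_ge0// -lerBlDl sub0r cos_geN1.
by have := cos_le1 u; lra.
Qed.

(** Differentiating the kernel lowers its power by one and produces
    [sin u ^+ 2 = (1 - cos u) * (1 + cos u)], whose second factor restores the power; then [cos u]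
    is written as [1 - (1 - cos u)]. *)
Lemma is_derive_vp_kernel N (u : R) :
  is_derive u 1 (fun u => sin u * vp_kernel N u)
    (vp_kernel N u - N.+1%:R * (vp_kernel N u * (1 - cos u))).
Proof.
apply: isd_eq.
  apply: isdM; apply: isdX; apply: isdM; apply: isdD; exact: isdC.
rewrite /vp_kernel; case: N => [|N]; first by rewrite !expr0 /=; ring.
have s2 : sin u * sin u = (1 - cos u) * (1 + cos u).
  by have := cos2Dsin2 u; rewrite !expr2 => h; lra.
rewrite /= exprS.
set b := (_ / 2) ^+ N.
have := congr1 ( *%R (N.+1%:R * b / 2)) s2.
rewrite scaler0 scaler0 add0r add0r -(natr1 N.+1) /GRing.scale /= => H.
lra.
Qed.

Lemma vp_kernelB_cont N (x : R) : continuous (fun y : R => vp_kernel N (x - y)).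
Proof.
have c1 : continuous (fun y : R => (1 + cos (-1 * y + x)) / 2).
  by move=> y; apply: cvgM; [apply: cvgD; [exact: cvg_cst|exact: continuous_cosl]|exact: cvg_cst].
have -> : (fun y : R => vp_kernel N (x - y)) = (fun y : R => ((1 + cos (-1 * y + x)) / 2) ^+ N).
  by apply/funext => y; rewrite mulN1r addrC.
elim: N => [|N ih] y; first by under eq_fun do rewrite expr0; exact: cvg_cst.
by under eq_fun do rewrite exprS; apply: cvgM; [exact: c1|exact: ih].
Qed.

Lemma continuous_cosB (x : R) : continuous (fun y : R => cos (x - y)).
Proof.
have -> : (fun y : R => cos (x - y)) = (fun y : R => cos (-1 * y + x)).
  by apply/funext => y; rewrite mulN1r addrC.
exact: continuous_cosl.
Qed.

Definition vp_mass (N : nat) (x : R) : R := intT (fun y : R => vp_kernel N (x - y)).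

Lemma vp_moment N (x : R) :
  N.+1%:R * intT (fun y : R => vp_kernel N (x - y) * (1 - cos (x - y))) = vp_mass N x.
Proof.
have c1 := @vp_kernelB_cont N x.
have c2 : continuous (fun y : R => vp_kernel N (x - y) * (1 - cos (x - y))).
  move=> y; apply: cvgM; first exact: c1.
  by apply: cvgB; [exact: cvg_cst|exact: continuous_cosB].
have d (y : R) : is_derive y 1 (fun y : R => sin (-1 * y + x) * vp_kernel N (-1 * y + x))
    (N.+1%:R * (vp_kernel N (x - y) * (1 - cos (x - y))) + - vp_kernel N (x - y)).
  apply: isd_eq; first exact: (isd_lin (is_derive_vp_kernel N (-1 * y + x))).
  by rewrite (_ : -1 * y + x = x - y); ring.
have pi2 : 0 <= 2 * pi :> R by rewrite mulr_ge0 ?pi_ge0.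
have := @Rintegral_FTC2 _ _ _ _ _ pi2 d.
have per : sin (-1 * (2 * pi) + x) * vp_kernel N (-1 * (2 * pi) + x) =
    sin (-1 * 0 + x) * vp_kernel N (-1 * 0 + x).
  have -> : -1 * 0 + x = (-1 * (2 * pi) + x) + pi *+ 2 by rewrite -mulr_natl; ring.
  by rewrite /vp_kernel cosD2pi sinD2pi.
rewrite per subrr => H; have {H} := H _.
move=> /(_ _)/wrap[].
  move=> y; apply: cvgD; first by apply: cvgM; [exact: cvg_cst|exact: c2].
  by apply: cvgN; exact: c1.
have := intTD (L1TZ N.+1%:R (continuous_L1T c2)) (L1TZ (-1) (continuous_L1T c1)).
rewrite !intTZ; [|exact: continuous_L1T..].
rewrite mulN1r /vp_mass => h1 h2; apply/eqP; rewrite -subr_eq0 -h1 -h2.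
by apply/eqP; apply: eq_Rintegral => y _; rewrite mulN1r.
Qed.

(** The extra factor [(1 + cos) / 2] is [1 - (1 - cos) / 2], and [vp_moment] evaluates the
    correction. *)
Lemma vp_massS N (x : R) :
  vp_mass N.+1 x = vp_mass N x * (1 - (2 * N.+1%:R)^-1).
Proof.
have c1 := @vp_kernelB_cont N x.
have c2 : continuous (fun y : R => vp_kernel N (x - y) * (1 - cos (x - y))).
  move=> y; apply: cvgM; first exact: c1.
  by apply: cvgB; [exact: cvg_cst|exact: continuous_cosB].
have N0 : N.+1%:R != 0 :> R by rewrite pnatr_eq0.
have -> : vp_mass N x * (1 - (2 * N.+1%:R)^-1) =
    vp_mass N x + (- 2^-1) * intT (fun y : R => vp_kernel N (x - y) * (1 - cos (x - y))).
  by rewrite -vp_moment; move: (N.+1%:R : R) N0 => n n0; field.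
rewrite -intTZ; last exact: continuous_L1T.
rewrite /vp_mass -intTD; [|exact: continuous_L1T|exact/L1TZ/continuous_L1T].
by apply: eq_Rintegral => y _; rewrite /vp_kernel exprS; field.
Qed.

(** The recursion shows that the mass does not depend on the centre [x], without appeal to
    translation invariance over a period. *)
Fixpoint vp_value (N : nat) : R :=
  if N is N'.+1 then vp_value N' * (1 - (2 * N'.+1%:R)^-1) else 2 * pi.

Lemma vp_massE N (x : R) : vp_mass N x = vp_value N.
Proof.
elim: N => [|N ih]; last by rewrite vp_massS ih.
rewrite /vp_mass /= -[RHS]mul1r -intT_cst.
by apply: eq_Rintegral => y _; rewrite /vp_kernel expr0.
Qed.

Lemma vp_value_gt0 N : 0 < vp_value N.
Proof.
elim: N => [|N ih] /=; first by rewrite mulr_gt0// pi_gt0.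
rewrite mulr_gt0// subr_gt0 invf_lt1; last by rewrite mulr_gt0// ltr0n.
have h1 : (1 : R) <= N.+1%:R by rewrite ler1n.
lra.
Qed.

Lemma sin_ge_cubic (s : R) : 0 <= s -> s - s ^+ 3 / 6 <= sin s.
Proof.
have h1 (t : R) : 0 <= t -> sin t <= t.
  move=> t0; apply: (@le_derive _ sin (fun t => t) cos (fun=> 1)) => //.
  by rewrite sin0.
have h2 (t : R) : 0 <= t -> 1 - t ^+ 2 / 2 <= cos t.
  move=> t0; have -> : 1 - t ^+ 2 / 2 = 1 + - (2^-1) * t ^+ 2 by ring.
  have d (u : R) : is_derive u 1 (fun t : R => 1 + - (2^-1) * t ^+ 2) (- u).
    apply: isd_eq; rewrite /GRing.scale /=. by field.
  apply: (@le_derive _ (fun t => 1 + - (2^-1) * t ^+ 2) cos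
      (fun t => - t) (fun t => - sin t)) => //.
  - by rewrite cos0 expr0n /=; lra.
  - by move=> u u0; rewrite lerN2; exact: h1.
move=> s0; have -> : s - s ^+ 3 / 6 = s + - (6^-1) * s ^+ 3 by ring.
have d (u : R) : is_derive u 1 (fun t : R => t + - (6^-1) * t ^+ 3) (1 - u ^+ 2 / 2).
  apply: isd_eq; rewrite /GRing.scale /=. by field.
apply: (@le_derive _ (fun t => t + - (6^-1) * t ^+ 3) sin
      (fun t => 1 - t ^+ 2 / 2) cos) => //.
- by rewrite sin0 expr0n /=; lra.
Qed.

(** With [e = d / 2 <= 2] the cubic bound gives [sin e >= e / 3], and [1 - cos d = 2 * sin e ^+ 2];
    hence the constant 18. *)
Lemma cos_le_quadratic (d : R) : 0 <= d <= pi -> d ^+ 2 / 18 <= 1 - cos d.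
Proof.
move=> /andP[d0 dpi].
have e0 : 0 <= d / 2 by rewrite divr_ge0.
have := sin_ge_cubic e0; set e := d / 2 in e0 *.
have e2 : e <= 2 by have := @pihalf_lt2 R; rewrite /e; lra.
have -> : d = e *+ 2 by rewrite /e mulr2n; lra.
rewrite cos_mulr2n => h.
have h' : e / 3 <= sin e.
  apply: le_trans h; rewrite -subr_ge0.
  have -> : e - e ^+ 3 / 6 - e / 3 = e * (2 - e) * (2 + e) / 6 by field.
  by rewrite divr_ge0// mulr_ge0// ?mulr_ge0//; lra.
have h2 : (e / 3) ^+ 2 <= sin e ^+ 2.
  by rewrite ler_sqr ?nnegrE//; [lra|apply: le_trans h'; lra].
have := cos2Dsin2 e => h3.
have -> : (e *+ 2) ^+ 2 / 18 = 2 * (e / 3) ^+ 2 by rewrite -mulr_natl; field.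
rewrite -[cos e ^+ 2 *+ 2]mulr_natl; lra.
Qed.

(** Young's inequality [L e <= eta + L^2 e^2 / (4 eta)] followed by [e^2 <= 18 (1 - cos e)]; the 9/2
    is 18/4. *)
Lemma le_cos_gap (L eta e : R) : 0 < eta -> 0 <= e <= pi ->
  L * e <= eta + (9 / 2 * L ^+ 2 / eta) * (1 - cos e).
Proof.
move=> eta0 e0; have := cos_le_quadratic e0 => h.
have k0 : 0 <= 9 / 2 * L ^+ 2 / eta.
  by apply: divr_ge0; last exact: ltW; apply: mulr_ge0; rewrite ?sqr_ge0//; lra.
apply: (@le_trans _ _ (eta + 9 / 2 * L ^+ 2 / eta * (e ^+ 2 / 18))); last first.
  by rewrite lerD2l ler_wpM2l.
rewrite -subr_ge0.
have -> : eta + 9 / 2 * L ^+ 2 / eta * (e ^+ 2 / 18) - L * e =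
    (eta - L * e / 2) ^+ 2 / eta by field; exact: lt0r_neq0.
by rewrite divr_ge0 ?sqr_ge0// ltW.
Qed.

(** Puts a Lipschitz bound in the form that the moment of the kernel can integrate. Only the
    distance on the circle matters: when [x] and [y] are more than [pi] apart, the smaller one is
    moved by a full period, which is why the derivative is bounded up to [4 * pi]. *)
Lemma cos_gap_modulus (phi dphi : R -> R) (L eta : R) (x y : R) :
  (forall t : R, is_derive t 1 phi (dphi t)) -> (forall t : R, phi (t + 2 * pi) = phi t) ->
  (forall t : R, t \in `[0, 4 * pi] -> `|dphi t| <= L) -> 0 < eta ->
  x \in `[0, 2 * pi] -> y \in `[0, 2 * pi] ->
  `|phi y - phi x| <= eta + (9 / 2 * L ^+ 2 / eta) * (1 - cos (x - y)).
Proof.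
move=> dp per hL eta0.
have lip (a b : R) : 0 <= a -> a <= b -> b <= 4 * pi -> `|phi b - phi a| <= L * (b - a).
  move=> a0 ab b4; have [c + ->] := @MVT_segment R phi dphi a b ab (fun t _ => dp t)
    (continuous_subspaceT (is_derive_continuous dp)).
  rewrite in_itv /= => /andP[ac cb].
  rewrite normrM [`|b - a|]ger0_norm ?subr_ge0// ler_wpM2r ?subr_ge0//.
  by apply: hL; rewrite in_itv /= (le_trans a0 ac) (le_trans cb b4).
have pi0 := @pi_gt0 R.
have main (a b : R) : a <= b -> a \in `[0, 2 * pi] -> b \in `[0, 2 * pi] ->
    `|phi b - phi a| <= eta + (9 / 2 * L ^+ 2 / eta) * (1 - cos (a - b)); last first.
  move=> xT yT; have [xy|/ltW yx] := leP x y; first exact: main.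
  by rewrite distrC -cosN opprB; exact: main.
move: a b => {}x {}y xy.
rewrite !in_itv /= => /andP[x0 x2] /andP[y0 y2].
rewrite -cosN opprB; have [d|d] := leP (y - x) pi.
  apply: (@le_trans _ _ (L * (y - x))); first by apply: lip => //; lra.
  by apply: le_cos_gap => //; lra.
rewrite -(per x) distrC.
apply: (@le_trans _ _ (L * (x + 2 * pi - y))); first by apply: lip => //; lra.
have -> : cos (y - x) = cos (x + 2 * pi - y).
  by rewrite -cosN -[in LHS]cosD2pi; congr cos; rewrite -mulr_natl; ring.
by apply: le_cos_gap => //; lra.
Qed.

(** * An integrable function with vanishing coefficients annihilates smooth periodic functions *)

Section coefficients.
Variable h : R -> R.
Hypothesis hL : L1T h.

Let null q := forall p : int, intT (fun x => h x * q x * cos (p%:~R * x)) = 0 /\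
  intT (fun x => h x * q x * sin (p%:~R * x)) = 0.

Let comb5 (f1 f2 f3 f4 f5 : R -> R) (a1 a2 a3 a4 a5 : R) :
  L1T f1 -> L1T f2 -> L1T f3 -> L1T f4 -> L1T f5 ->
  intT f1 = 0 -> intT f2 = 0 -> intT f3 = 0 -> intT f4 = 0 -> intT f5 = 0 ->
  intT (fun x => a1 * f1 x + (a2 * f2 x + (a3 * f3 x + (a4 * f4 x + a5 * f5 x)))) = 0.
Proof.
move=> l1 l2 l3 l4 l5 i1 i2 i3 i4 i5.
rewrite !intTD ?intTZ// ?i1 ?i2 ?i3 ?i4 ?i5 ?mulr0 ?addr0//; by do ?apply: L1TD; apply: L1TZ.
Qed.

(** By the product-to-sum formulas one more kernel factor only mixes the frequencies [p], [p + 1]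
    and [p - 1], so orthogonality to all frequencies is preserved. *)
Lemma null_mul q (y : R) : continuous q -> null q ->
  null (fun x => (1 + cos (x - y)) / 2 * q x).
Proof.
move=> cq nq p.
have cp (r : int) : continuous (fun x : R => cos (r%:~R * x)).
  by have := @continuous_cosl r%:~R 0; under eq_fun do rewrite addr0.
have sp (r : int) : continuous (fun x : R => sin (r%:~R * x)).
  by have := @continuous_sinl r%:~R 0; under eq_fun do rewrite addr0.
have lA r : L1T (fun x => h x * q x * cos (r%:~R * x)) by exact/L1TM/cp/L1TM.
have lB r : L1T (fun x => h x * q x * sin (r%:~R * x)) by exact/L1TM/sp/L1TM.
have nA r := (nq r).1. have nB r := (nq r).2.
have e1 (x : R) : (p + 1)%:~R * x = p%:~R * x + x by rewrite intrD; ring.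
have e2 (x : R) : (p - 1)%:~R * x = p%:~R * x - x by rewrite intrB; ring.
split.
- rewrite -(@comb5 _ _ _ _ _ (1 / 2) (cos y / 4) (cos y / 4) (sin y / 4) (- sin y / 4)
    (lA p) (lA (p + 1)) (lA (p - 1)) (lB (p + 1)) (lB (p - 1))) //.
  by apply: eq_Rintegral => x _; rewrite e1 e2 !cosD !sinD !cosN !sinN; field.
- rewrite -(@comb5 _ _ _ _ _ (1 / 2) (cos y / 4) (cos y / 4) (sin y / 4) (- sin y / 4)
    (lB p) (lB (p + 1)) (lB (p - 1)) (lA (p - 1)) (lA (p + 1))) //.
  by apply: eq_Rintegral => x _; rewrite e1 e2 !cosD !sinD !cosN !sinN; field.
Qed.

Hypothesis h0 : forall p : int, intT (fun x => h x * cos (p%:~R * x)) = 0 /\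
  intT (fun x => h x * sin (p%:~R * x)) = 0.

Lemma continuous_vp_kernel N (y : R) : continuous (fun x : R => vp_kernel N (x - y)).
Proof.
have -> : (fun x => vp_kernel N (x - y)) = (fun x => vp_kernel N (y - x)).
  by apply/funext => x; rewrite /vp_kernel -cosN opprB.
exact: vp_kernelB_cont.
Qed.

Lemma intT_vp_kernel N (y : R) : intT (fun x => h x * vp_kernel N (x - y)) = 0.
Proof.
have : null (fun x => vp_kernel N (x - y)).
  elim: N => [|N ih].
    move=> p; have [h1 h2] := h0 p; rewrite -[RHS]h1 -[in X in _ /\ X]h2.
    by split; apply: eq_Rintegral => x _; rewrite /vp_kernel expr0 mulr1.
  have -> : (fun x => vp_kernel N.+1 (x - y)) =
      (fun x => (1 + cos (x - y)) / 2 * vp_kernel N (x - y)).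
    by apply/funext => x; rewrite /vp_kernel exprS.
  by apply: null_mul => //; exact: continuous_vp_kernel.
move=> /(_ 0)[+ _] => <-; apply: eq_Rintegral => x _.
by rewrite mul0r cos0 mulr1.
Qed.

(* Test [h] against the convolution of [phi] with [vp_kernel N]: the pairing vanishes
   by Fubini, and tends to that of [h] and [phi]. *)
Lemma fourier_uniqueness (phi dphi : R -> R) :
  (forall t : R, is_derive t 1 phi (dphi t)) -> continuous dphi ->
  (forall t : R, phi (t + 2 * pi) = phi t) ->
  intT (fun x => h x * phi x) = 0.
Proof.
move=> dphiE cdphi per.
have cphi : continuous phi := is_derive_continuous dphiE.
have pi2 : 0 <= 2 * pi :> R by rewrite mulr_ge0 ?pi_ge0.
have [L [L0 hL']] := @continuous_bounded_rectangle R (fun _ => dphi) 0 1 0 (4 * pi)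
  ltac:(by move=> p; apply: (continuous_comp _ (@cdphi p.2)); exact: cvg_snd).
have {}hL' t : t \in `[0, 4 * pi] -> `|dphi t| <= L.
  by apply: (hL' 0); rewrite in_itv /= lexx ler01.
have nh : L1T (fun x => `|h x|) by have := integrable_norm hL; apply.
set H := intT (fun x => `|h x|).
have H0 : 0 <= H by exact: Rintegral_ge0.
have cF N : continuous (fun p : R * R => vp_kernel N (p.1 - p.2) * phi p.2).
  move=> p; apply: cvgM.
    have := @continuous_vp_kernel N 0; under eq_fun do rewrite subr0.
    move=> cN; apply: (@continuous_comp _ _ _ (fun p : R * R => p.1 - p.2) (vp_kernel N) p);
      last exact: cN.
    by apply: cvgB; [exact: cvg_fst|exact: cvg_snd].
  by apply: (continuous_comp _ (cphi _)); exact: cvg_snd.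
have cconv N : continuous (fun x : R => intT (fun y => vp_kernel N (x - y) * phi y)).
  exact: (@continuous_intT R (fun x y => vp_kernel N (x - y) * phi y) (cF N)).
have cFx N x := @continuous_section2 R (fun x y => vp_kernel N (x - y) * phi y) x (cF N).
have avg N : intT (fun x => h x * intT (fun y => vp_kernel N (x - y) * phi y)) = 0.
  (* [h] is measurable on the period only; its extension by zero is measurable on the line, as
     Fubini requires. *)
  pose h' := h \_ torus.
  have h'E x : torus x -> h' x = h x by move=> xT; rewrite /h' patchE mem_set.
  have [M [M0 hM]] := @continuous_bounded_rectangle R (fun _ => phi) 0 1 0 (2 * pi)
    ltac:(by move=> p; apply: (continuous_comp _ (@cphi p.2)); exact: cvg_snd).
  have -> : intT (fun x => h x * intT (fun y => vp_kernel N (x - y) * phi y)) =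
      intT (fun x => intT (fun y => h' x * (vp_kernel N (x - y) * phi y))).
    apply: eq_Rintegral => x /set_mem xT; rewrite h'E// intTZ//.
    exact/continuous_L1T/cFx.
  rewrite /intT (@Rintegral_Fubini R torus torus
    (fun x y => h' x * (vp_kernel N (x - y) * phi y)) (fun x => `|h' x| * M)).
  - rewrite -[RHS](mul0r (2 * pi)) -intT_cst; apply: eq_Rintegral => y _.
    rewrite -[RHS](mulr0 (phi y)) -(intT_vp_kernel N y) -intTZ; last first.
      by apply: L1TM => //; exact: continuous_vp_kernel.
    by apply: eq_Rintegral => x /set_mem xT; rewrite h'E//; ring.
  - exact: measurable_torus.
  - exact: measurable_torus.
  - by rewrite /torus lebesgue_measure_itv /=; case: ifP => _; rewrite ?ltry// -EFinB ltry.
  - rewrite /jmeas; apply: measurable_funM.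
      apply: (@measurableT_comp _ _ _ _ _ _ h' _ fst) => //.
      apply/(measurable_restrictT _ measurable_torus).
      by apply/measurable_EFinP; exact: (measurable_int mu hL).
    apply: measurable_funM.
      apply: (@measurableT_comp _ _ _ _ _ _ (vp_kernel N) _ (fun p : R * R => p.1 - p.2)) => //.
        apply: continuous_measurable_fun.
        by have := @continuous_vp_kernel N 0; under eq_fun do rewrite subr0.
      by apply: measurable_funB.
    apply: (@measurableT_comp _ _ _ _ _ _ phi _ snd) => //.
    exact: continuous_measurable_fun.
  - have : L1T (fun x => `|h x| * cst M x) by apply: L1TM => // x; exact: cvg_cst.
    apply: eq_integrable; first exact: measurable_torus.
    by move=> x /set_mem xT; rewrite /= h'E.
  - move=> x y xT yT; rewrite normrM ler_wpM2l// normrM ger0_norm ?vp_kernel_ge0//.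
    apply: (@le_trans _ _ (1 * `|phi y|)); first by rewrite ler_wpM2r// vp_kernel_le1.
    by rewrite mul1r; apply: (hM 0) => //; rewrite in_itv /= lexx ler01.
(* Since the convolution pairs to zero with [h], only the error [E] of the approximation counts.
   Integrating [cos_gap_modulus] against the kernel bounds it by the mass times [eta + C / N.+1],
   and the positive mass cancels. *)
have key (eta : R) N : 0 < eta -> `|intT (fun x => h x * phi x)| <=
    H * (eta + 9 / 2 * L ^+ 2 / eta / N.+1%:R).
  move=> eta0; set C := 9 / 2 * L ^+ 2 / eta.
  pose E x := vp_value N * phi x - intT (fun y => vp_kernel N (x - y) * phi y).
  have cE : continuous E.
    move=> x; apply: cvgB; last exact: cconv.
    by apply: cvgM; [exact: cvg_cst|exact: cphi].
  have EB x : x \in torus -> `|E x| <= vp_value N * (eta + C / N.+1%:R).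
    move=> xT.
    have cK := @vp_kernelB_cont N x.
    have cD : continuous (fun y : R => vp_kernel N (x - y) * (phi x - phi y)).
      by move=> y; apply: cvgM; [exact: cK|apply: cvgB; [exact: cvg_cst|exact: cphi]].
    have cM : continuous (fun y : R => vp_kernel N (x - y) * (1 - cos (x - y))).
      by move=> y; apply: cvgM; [exact: cK|apply: cvgB; [exact: cvg_cst|exact: continuous_cosB]].
    have -> : E x = intT (fun y => vp_kernel N (x - y) * (phi x - phi y)).
      rewrite /E -(vp_massE N x) /vp_mass mulrC -intTZ; last exact: continuous_L1T.
      rewrite -intTN; last exact/continuous_L1T/cFx.
      rewrite -intTD; [|exact/L1TZ/continuous_L1T|]; last first.
        have := L1TZ (-1) (continuous_L1T (cFx N x)).
        by under eq_fun do rewrite mulN1r.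
      by apply: eq_Rintegral => y _; ring.
    apply: (le_trans (intT_norm (continuous_L1T cD))).
    have -> : vp_value N * (eta + C / N.+1%:R) =
        intT (fun y => eta * vp_kernel N (x - y) + C * (vp_kernel N (x - y) * (1 - cos (x - y)))).
      rewrite intTD ?intTZ; try by [exact: continuous_L1T|exact/L1TZ/continuous_L1T].
      rewrite -(vp_massE N x) mulrDr mulrC; congr (_ + _).
      have n0 : N.+1%:R != 0 :> R by rewrite pnatr_eq0.
      by rewrite -{1}vp_moment; move: (N.+1%:R : R) n0 => n n0; field.
    apply: intT_le => [||y yT].
    - by have := integrable_norm (continuous_L1T cD); apply.
    - by apply: L1TD; apply: L1TZ; exact: continuous_L1T.
    - rewrite normrM ger0_norm ?vp_kernel_ge0// distrC.
      rewrite (_ : eta * _ + _ = vp_kernel N (x - y) * (eta + C * (1 - cos (x - y)))); last by ring.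
      rewrite ler_wpM2l ?vp_kernel_ge0//; apply: (cos_gap_modulus dphiE) => //.
      + by move: xT => /set_mem.
      + by move: yT => /set_mem.
  have hE : intT (fun x => h x * E x) = vp_value N * intT (fun x => h x * phi x).
    rewrite -intTZ; last exact: L1TM.
    rewrite -[LHS]addr0 -{1}(avg N) -intTD; [|exact: L1TM|exact/L1TM/cconv].
    by apply: eq_Rintegral => x _; rewrite /E; ring.
  rewrite -(ler_pM2l (vp_value_gt0 N)) -[X in X * `|_|](gtr0_norm (vp_value_gt0 N)) -normrM -hE.
  apply: (le_trans (intT_norm (L1TM hL cE))).
  rewrite mulrCA mulrC -intTZ//; apply: intT_le.
  - by have := integrable_norm (L1TM hL cE); apply.
  - exact: L1TZ.
  - by move=> x xT; rewrite normrM mulrC ler_wpM2r// EB.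
apply/eqP; rewrite -normr_le0; apply/ler_addgt0Pl => e e0; rewrite addr0.
(* Two errors of size [eta], each multiplied by [H], must stay below [e]; the [+ 1] covers
   [H = 0]. *)
pose eta := e / (2 * (H + 1)).
have eta0 : 0 < eta by rewrite divr_gt0// mulr_gt0// ltr_wpDl.
set C := 9 / 2 * L ^+ 2 / eta in key.
have [N hN] : exists N, C / N.+1%:R <= eta.
  exists (Num.bound (C / eta)); rewrite ler_pdivrMr ?ltr0n// mulrC -ler_pdivrMr//.
  have C0 : 0 <= C / eta.
    by rewrite !mulr_ge0// ?invr_ge0 ?ltW//; nra.
  apply: (le_trans (ltW (archi_boundP C0))); by rewrite ler_nat.
apply: (le_trans (key eta N eta0)).
apply: (@le_trans _ _ (H * (eta + eta))); first by rewrite ler_wpM2l// lerD2l.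
rewrite /eta.
have -> : H * (e / (2 * (H + 1)) + e / (2 * (H + 1))) = e * (H / (H + 1)).
  by field; apply/eqP => HH; lra.
rewrite -[leRHS]mulr1 ler_pM2l// ler_pdivrMr ?ltr_wpDl//; lra.
Qed.

End coefficients.

End uniqueness.

(** * Tree expansion and energy estimate *)

Inductive tree := Leaf of nat | Node of bool & tree & tree.

(* [Node s l r] stands for the wave of phase [b + a] ([s = false]) or [b - a]
   ([s = true]) in the product of [sin b] (subtree [r]) and [cos a] (subtree [l]). *)
Fixpoint freq (u : tree) : int :=
  match u with
  | Leaf j => j%:Z
  | Node s l r => freq r + (-1) ^+ s * freq l
  end.

(** One index truncates both the leaf frequencies and the depth: levels are finite, [Leaf q] enters
    at level [q + 1], and the nodes of a level are exactly the signed ordered pairs from the level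
    below. Leaves have nonnegative frequency, a real cosine carrying both signs. *)
Fixpoint level (k : nat) : seq tree :=
  if k is k'.+1 then
    [seq Leaf j | j <- iota 0 k] ++
    ([seq Node false l r | l <- level k', r <- level k'] ++
     [seq Node true l r | l <- level k', r <- level k'])
  else [::].

Section trees.
Context {R : realType}.

Definition fr (u : tree) : R := (freq u)%:~R.

Lemma fr_node s l r : fr (Node s l r) = fr r + (-1) ^+ s * fr l.
Proof. by rewrite /fr /= intrD intrM; case: s => //=; rewrite !(expr0, expr1) ?intrN. Qed.

Lemma fr_neq0 u : freq u != 0 -> 1 <= `|fr u|.
Proof. by move=> u0; rewrite /fr -intr_norm (ler_int R 1) -gtz0_ge1 normr_gt0. Qed.

Lemma sum_level_succ k (f : tree -> R) :
  \sum_(u <- level k.+1) f u = \sum_(j <- iota 0 k.+1) f (Leaf j) +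
  \sum_(l <- level k) \sum_(r <- level k) (f (Node false l r) + f (Node true l r)).
Proof.
have -> : level k.+1 = [seq Leaf j | j <- iota 0 k.+1] ++
    ([seq Node false l r | l <- level k, r <- level k] ++
     [seq Node true l r | l <- level k, r <- level k]) by [].
rewrite !big_cat big_map; congr (_ + _).
rewrite /= !big_allpairs_dep -big_split; apply: eq_bigr => l _.
by rewrite -big_split.
Qed.

(** The node part is a double sum, so the induction hypothesis is needed for two other functions, of
    the right and of the left subtree; hence the induction over all [f]. *)
Lemma sum_level_le k (f : tree -> R) : (forall u, 0 <= f u) ->
  \sum_(u <- level k) f u <= \sum_(u <- level k.+1) f u.
Proof.
elim: k f => [|k ih] f f0; first by rewrite big_nil sumr_ge0.
rewrite sum_level_succ sum_level_succ lerD//.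
  by rewrite -[in iota 0 k.+2]addn1 iotaD big_cat /= lerDl sumr_ge0.
apply: le_trans (ih _ _) => [|l]; last by apply: sumr_ge0 => r _; rewrite addr_ge0.
by apply: ler_sum => l _; apply: ih => r; rewrite addr_ge0.
Qed.

Lemma sum_level_homo k m (f : tree -> R) : (forall u, 0 <= f u) -> (k <= m)%N ->
  \sum_(u <- level k) f u <= \sum_(u <- level m) f u.
Proof.
move=> f0 /subnK <-; elim: (m - k)%N => // d ih.
by apply: (le_trans ih); rewrite addSn; exact: sum_level_le.
Qed.

End trees.
Arguments fr {R} u.

(** * Amplitudes of trees *)

Section amplitudes.
Context {R : realType}.
Variables (eps beta : R) (rho : nat -> R).

Definition sigma (u : tree) : R := beta * fr u ^+ 4 - fr u ^+ 2.

(** On the wave of [r], [zeta_x + beta zeta_xxx] gives [-(n_r - beta n_r^3) sin b]. Multiplying by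
    [cos a] leaves half a sine for each sign [s], and the outer [-eps d/dx] brings down the total
    frequency. *)
Definition coupling (s : bool) (l r : tree) : R :=
  eps / 2 * (fr (Node s l r) * (fr r - beta * fr r ^+ 3)).

(** Duhamel's formula with zero initial value at nodes: only leaves are present at time zero. *)
Fixpoint amp (u : tree) : R -> R :=
  match u with
  | Leaf j => fun t => expR (- sigma (Leaf j) * t) * rho j
  | Node s l r => fun t => expR (- sigma (Node s l r) * t) *
      prim (fun t' => expR (sigma (Node s l r) * t') *
                      (`|coupling s l r| * (amp l t' * amp r t'))) t
  end.

Definition source (u : tree) (t : R) : R :=
  if u is Node s l r then `|coupling s l r| * (amp l t * amp r t) else 0.

Lemma is_derive_expRl (a t : R) : is_derive t 1 (fun t => expR (a * t)) (a * expR (a * t)).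
Proof.
have := @isd_lin R expR t a 0 _ (is_derive_expR _).
by under eq_fun do rewrite addr0; rewrite addr0.
Qed.

Lemma continuous_expRl (a : R) : continuous (fun t : R => expR (a * t)).
Proof. by apply: is_derive_continuous => t; exact: is_derive_expRl. Qed.

Lemma is_derive_amp u (t : R) :
  is_derive t 1 (amp u) (- sigma u * amp u t + source u t).
Proof.
elim: u t => [j|s l ihl r ihr] t.
  apply: (isd_eq (isdM (is_derive_expRl (- sigma (Leaf j)) t) (isdC t (rho j)))).
  by rewrite /=; ring.
have cl : continuous (amp l) := is_derive_continuous ihl.
have cr : continuous (amp r) := is_derive_continuous ihr.
have cs : continuous (fun t' : R => expR (sigma (Node s l r) * t') *
                      (`|coupling s l r| * (amp l t' * amp r t'))).
  move=> x; apply: cvgM; first exact: continuous_expRl.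
  by apply: cvgM; [exact: cvg_cst|apply: cvgM; [exact: cl|exact: cr]].
have dp := isdM (is_derive_expRl (- sigma (Node s l r)) t) (is_derive_prim t cs).
apply: (isd_eq dp).
have e : expR (- sigma (Node s l r) * t) * expR (sigma (Node s l r) * t) = 1.
  by rewrite -expRD mulNr addNr expR0.
rewrite [in RHS]/source [amp (Node _ _ _) t]/= [X in _ + X]mulrA e mul1r.
by rewrite -mulrA.
Qed.

Lemma continuous_amp u : continuous (amp u).
Proof. exact: is_derive_continuous (is_derive_amp u). Qed.

Lemma continuous_source u : continuous (source u).
Proof.
case: u => [j|s l r] x; first exact: cvg_cst.
apply: cvgM; first exact: cvg_cst.
by apply: cvgM; exact: continuous_amp.
Qed.

Hypothesis rho_ge0 : forall j, 0 <= rho j.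

Lemma amp_ge0 u (t : R) : 0 <= t -> 0 <= amp u t.
Proof.
elim: u t => [j|s l ihl r ihr] t t0 /=; first by rewrite mulr_ge0// expR_ge0.
rewrite mulr_ge0 ?expR_ge0// prim_ge//; apply: Rintegral_ge0 => x.
by rewrite /= in_itv /= => /andP[x0 _]; rewrite !mulr_ge0 ?expR_ge0// (ihl,ihr).
Qed.

Lemma source_ge0 u (t : R) : 0 <= t -> 0 <= source u t.
Proof. by case: u => //= s l r t0; rewrite !mulr_ge0// amp_ge0. Qed.

Hypothesis rho0 : rho 0 = 0.

(** The coupling contains the total frequency as a factor, and the zero leaf is killed by the zero
    mean. Every tree that counts thus has frequency at least 1 in modulus, which makes higher powers
    of it dominate lower ones. *)
Lemma amp_freq0 u (t : R) : freq u = 0 -> amp u t = 0.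
Proof.
case: u => [j|s l r] /= u0; first by case: u0 => ->; rewrite rho0 mulr0.
have c0 : coupling s l r = 0 by rewrite /coupling /fr /= u0 mul0r mulr0.
rewrite (_ : prim _ t = 0) ?mulr0// /prim c0 normr0.
have z D : \int[@lebesgue_measure R]_(x in D)
    (expR (sigma (Node s l r) * x) * (0 * (amp l x * amp r x))) = 0.
  rewrite /Rintegral integral0_eq// => x _; by rewrite mul0r mulr0.
by rewrite !z subrr.
Qed.

Lemma amp_leaf0 j : amp (Leaf j) 0 = rho j.
Proof. by rewrite /= mulr0 expR0 mul1r. Qed.

Lemma amp_node0 s l r : amp (Node s l r) 0 = 0.
Proof. by rewrite /= prim0 mulr0. Qed.

Lemma sum_amp0 k (f : tree -> R) :
  \sum_(u <- level k.+1) f u * amp u 0 = \sum_(j <- iota 0 k.+1) f (Leaf j) * rho j.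
Proof.
rewrite sum_level_succ [X in _ + X]big1 ?addr0.
  by apply: eq_bigr => j _; rewrite amp_leaf0.
by move=> l _; rewrite big1// => r _; rewrite !amp_node0 !mulr0 addr0.
Qed.

(** * Weighted estimate, uniform in the level *)

Section estimate.
Variables (z0 : R).
Hypothesis eps0 : 0 < eps.
Hypothesis beta1 : 1 < beta.
Hypothesis rho_sum : forall k, \sum_(j <- iota 0 k) rho j <= z0.
Hypothesis small : 8 * eps * (beta + 1) * z0 <= beta - 1.

Local Ltac slra := have := eps0; have := beta1; lra.

Variables (nu c gam : R).
Hypothesis nu0 : 0 <= nu.
Hypothesis c0 : 0 <= c.
Hypothesis gam0 : 0 <= gam.
Hypothesis nu_lt : nu <= (beta - 1) / 2.
Hypothesis gam_le : gam + (beta - 1) / 4 + c <= (beta - 1) / 2.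

(* [nu] is the growth rate of the strip of analyticity and [c] the decay rate. *)
Definition weight u (t : R) : R := expR ((c + nu * `|fr u|) * t).

Definition mass k (t : R) : R := \sum_(u <- level k) weight u t * amp u t.

Definition mass4 k (t : R) : R :=
  \sum_(u <- level k) `|fr u| ^+ 4 * (weight u t * amp u t).

Lemma mass4_ge0 k (t : R) : 0 <= t -> 0 <= mass4 k t.
Proof.
move=> t0; apply: sumr_ge0 => u _.
by rewrite !mulr_ge0 ?expR_ge0 ?amp_ge0// exprn_ge0.
Qed.

Lemma continuous_mass4 k : continuous (mass4 k).
Proof.
exact: (is_derive_continuous (fun t => isd_sum (level k)
  (fun u => isdZ (`|fr u| ^+ 4) (isdM (is_derive_expRl _ t) (is_derive_amp u t))))).
Qed.

(** For [|n| >= 1] both [n^2] and [|n|] are at most [n^4], so [sigma >= (beta - 1) n^4]. Half of it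
    covers [nu |n|] by [nu_lt]; the other half covers [c], [gam] and the reserve [(beta - 1) / 4]
    for the source by [gam_le]. *)
Lemma damping u (t : R) : 0 <= t ->
  (c + nu * `|fr u| - sigma u + (gam + (beta - 1) / 4) * `|fr u| ^+ 4) * amp u t <= 0.
Proof.
move=> t0; have [u0|u0] := eqVneq (freq u) 0; first by rewrite amp_freq0// mulr0.
rewrite mulr_le0_ge0 ?amp_ge0//.
have h := @fr_neq0 R _ u0; rewrite /sigma.
have -> : fr u ^+ 4 = `|fr u| ^+ 4 :> R by rewrite -normrX ger0_norm// exprn_even_ge0.
have -> : fr u ^+ 2 = `|fr u| ^+ 2 :> R by rewrite -normrX ger0_norm// exprn_even_ge0.
move: (`|fr u|) h => n n1.
have n2 : n <= n ^+ 2 by rewrite -[leLHS]mulr1 expr2 ler_pM2l; lra.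
have n24 : n ^+ 2 <= n ^+ 4.
  by rewrite -[leLHS]mul1r (_ : n ^+ 4 = n ^+ 2 * n ^+ 2) ?ler_wpM2r ?sqr_ge0//; [lra|ring].
have h1 : nu * n <= (beta - 1) / 2 * n ^+ 4.
  by apply: ler_pM => //; lra.
have h2 : c <= c * n ^+ 4 by rewrite -[leLHS]mulr1 ler_wpM2l//; lra.
have h3 : (gam + (beta - 1) / 4 + c) * n ^+ 4 <= (beta - 1) / 2 * n ^+ 4.
  by rewrite ler_wpM2r//; lra.
lra.
Qed.

(** The strip weight is submultiplicative because frequencies obey the triangle inequality. A single
    [expR (c * t)] is spent on the pair, so one subtree can be measured without decay weight. *)
Lemma weight_node s l r (t : R) : 0 <= t ->
  weight (Node s l r) t <= expR (c * t) *
    (expR (nu * `|fr l| * t) * expR (nu * `|fr r| * t)).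
Proof.
move=> t0; rewrite /weight -!expRD ler_expR -!mulrDl ler_wpM2r//.
rewrite lerD2l -mulrDr ler_wpM2l// fr_node addrC (le_trans (ler_normD _ _))//.
by rewrite normrMsign.
Qed.

Lemma coupling_le s l r : `|coupling s l r| <=
  eps / 2 * ((`|fr l| + `|fr r|) * ((1 + beta) * `|fr r| ^+ 3)).
Proof.
have e2 : 0 <= eps / 2 by rewrite divr_ge0// ltW.
rewrite /coupling normrM (ger0_norm e2) ler_wpM2l// normrM; apply: ler_pM => //.
  by rewrite fr_node addrC (le_trans (ler_normD _ _))// normrMsign.
have [r0|r0] := eqVneq (freq r) 0.
  by rewrite /fr r0 expr0n /= mulr0 subr0 normr0 expr0n mulr0.
have h := @fr_neq0 R _ r0; apply: (le_trans (ler_normB _ _)).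
rewrite normrM normrX [`|beta|]gtr0_norm; last slra.
move: (`|fr r|) h => n n1.
rewrite mulrDl mul1r lerD2r exprS -[leLHS]mulr1 ler_wpM2l//; first slra.
by rewrite -[leLHS]mulr1 expr2 ler_pM//; lra.
Qed.

Lemma quartic_sum (a b : R) : 0 <= a -> 0 <= b ->
  (a + b) * b ^+ 3 + (b + a) * a ^+ 3 <= 2 * (a ^+ 4 + b ^+ 4).
Proof.
move=> a0 b0; rewrite -subr_ge0.
have -> : 2 * (a ^+ 4 + b ^+ 4) - ((a + b) * b ^+ 3 + (b + a) * a ^+ 3) =
  (a - b) ^+ 2 * (a ^+ 2 + a * b + b ^+ 2) by ring.
by rewrite mulr_ge0 ?sqr_ge0// !addr_ge0 ?sqr_ge0 ?mulr_ge0.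
Qed.

(** The two signs of a node cancel the 1/2 of the coupling. What remains is at most
    [2 eps (1 + beta) X] times the fourth-order mass, with [X <= z0], and the smallness condition
    turns this into a quarter of [beta - 1]. *)
Lemma sum_source k (t : R) : 0 <= t -> mass k t <= z0 ->
  \sum_(u <- level k.+1) weight u t * source u t <= (beta - 1) / 4 * mass4 k t.
Proof.
move=> t0 mz.
pose x u := expR (nu * `|fr u| * t) * amp u t.
have x0 u : 0 <= x u by rewrite mulr_ge0 ?expR_ge0 ?amp_ge0.
pose K := eps * (1 + beta) * expR (c * t).
have K0 : 0 <= K by rewrite !mulr_ge0 ?expR_ge0//; slra.
have wx u : weight u t * amp u t = expR (c * t) * x u.
  by rewrite /weight /x mulrDl expRD mulrA.
rewrite sum_level_succ [X in X + _]big1 ?add0r; last by move=> j _; rewrite mulr0.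
have node s l r : weight (Node s l r) t * source (Node s l r) t <=
    K / 2 * ((`|fr l| + `|fr r|) * `|fr r| ^+ 3 * (x l * x r)).
  apply: (@le_trans _ _ (expR (c * t) * (expR (nu * `|fr l| * t) * expR (nu * `|fr r| * t)) *
    (eps / 2 * ((`|fr l| + `|fr r|) * ((1 + beta) * `|fr r| ^+ 3)) * (amp l t * amp r t)))).
    apply: ler_pM; rewrite ?expR_ge0 ?source_ge0 ?weight_node//.
    by rewrite ler_wpM2r ?coupling_le// mulr_ge0 ?amp_ge0.
  by rewrite le_eqVlt /x /K; apply/orP; left; apply/eqP; ring.
pose T l r := (`|fr l| + `|fr r|) * `|fr r| ^+ 3 * (x l * x r).
apply: (@le_trans _ _ (K * \sum_(l <- level k) \sum_(r <- level k) T l r)).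
  rewrite mulr_sumr; apply: ler_sum => l _; rewrite mulr_sumr; apply: ler_sum => r _.
  apply: (le_trans (lerD (node _ _ _) (node _ _ _))).
  by rewrite le_eqVlt /T; apply/orP; left; apply/eqP; field.
pose X := \sum_(u <- level k) x u.
pose X4 := \sum_(u <- level k) `|fr u| ^+ 4 * x u.
have X40 : 0 <= X4 by apply: sumr_ge0 => u _; rewrite mulr_ge0// exprn_ge0.
have sT : \sum_(l <- level k) \sum_(r <- level k) T l r <= 2 * (X * X4).
  (* All derivatives fall on the right subtree; averaging with the mirrored pair makes the summand
     symmetric, as [quartic_sum] needs. *)
  have e2 : \sum_(l <- level k) \sum_(r <- level k) T l r =
            \sum_(l <- level k) \sum_(r <- level k) T r l by rewrite exchange_big.
  have -> : \sum_(l <- level k) \sum_(r <- level k) T l r =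
      2^-1 * \sum_(l <- level k) \sum_(r <- level k) (T l r + T r l).
    under [in RHS]eq_bigr do rewrite big_split.
    by rewrite big_split /= -e2; field.
  have -> : 2 * (X * X4) = 2^-1 * \sum_(l <- level k) \sum_(r <- level k)
      (2 * (`|fr l| ^+ 4 + `|fr r| ^+ 4) * (x l * x r)).
    have h : \sum_(l <- level k) \sum_(r <- level k) (x l * (`|fr r| ^+ 4 * x r)) = X * X4.
      by rewrite /X mulr_suml; apply: eq_bigr => l _; rewrite mulr_sumr.
    have h' : \sum_(l <- level k) \sum_(r <- level k) (`|fr l| ^+ 4 * x l * x r) = X * X4.
      by rewrite mulrC /X4 mulr_suml; apply: eq_bigr => l _; rewrite mulr_sumr.
    transitivity (X * X4 + X * X4); first by ring.
    rewrite -{1}h -h' -big_split mulr_sumr; apply: eq_bigr => l _.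
    by rewrite -big_split mulr_sumr; apply: eq_bigr => r _ /=; field.
  rewrite ler_wpM2l ?invr_ge0//; apply: ler_sum => l _; apply: ler_sum => r _.
  rewrite /T [x r * x l]mulrC -mulrDl ler_wpM2r ?(mulr_ge0 (x0 _) (x0 _))//.
  exact: quartic_sum.
apply: (@le_trans _ _ (K * (2 * (X * X4)))); first by rewrite ler_wpM2l.
have -> : mass4 k t = expR (c * t) * X4.
  by rewrite /mass4 /X4 mulr_sumr; apply: eq_bigr => u _; rewrite wx mulrCA.
(* Dropping the decay weight is allowed since [c >= 0] makes it at least 1. *)
have Xz : X <= z0.
  apply: le_trans mz; rewrite /mass /X; apply: ler_sum => u _.
  rewrite wx -[leLHS]mul1r ler_wpM2r//.
  by rewrite -(@expR0 R) ler_expR mulr_ge0.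
have -> : K * (2 * (X * X4)) = 2 * eps * (1 + beta) * X * (expR (c * t) * X4).
  by rewrite /K; ring.
rewrite ler_wpM2r ?mulr_ge0 ?expR_ge0//.
have : 2 * eps * (1 + beta) * X <= 2 * eps * (1 + beta) * z0.
  by rewrite ler_wpM2l// !mulr_ge0//; slra.
by move: small; lra.
Qed.

Lemma is_derive_mass k (t : R) : is_derive t 1 (mass k)
  (\sum_(u <- level k) (weight u t * ((c + nu * `|fr u| - sigma u) * amp u t) +
     weight u t * source u t)).
Proof.
apply: (isd_eq (isd_sum (level k)
  (fun u => isdM (is_derive_expRl (c + nu * `|fr u|) t) (is_derive_amp u t)))).
by apply: eq_bigr => u _; rewrite /weight; ring.
Qed.

Lemma mass_bound k (t : R) : 0 <= t -> mass k t + gam * prim (mass4 k) t <= z0.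
Proof.
elim: k t => [|k ih] t t0.
  rewrite /mass big_nil add0r (_ : prim _ t = 0) ?mulr0.
    by have := rho_sum 0; rewrite big_nil.
  have z D : \int[@lebesgue_measure R]_(x in D) mass4 0 x = 0.
    by rewrite /Rintegral integral0_eq// => x _; rewrite /mass4 big_nil.
  by rewrite /prim !z subrr.
have q0 : 0 <= (beta - 1) / 4 by slra.
have c4 j : continuous (mass4 j) by exact: continuous_mass4.
have Y0 j s : 0 <= s -> 0 <= prim (mass4 j) s.
  move=> s0; rewrite prim_ge//; apply: Rintegral_ge0 => x.
  by rewrite /= in_itv /= => /andP[x0 _]; exact: mass4_ge0.
(* The integral in the induction hypothesis is nonnegative, so that hypothesis also supplies the
   size bound required by [sum_source]. *)
have mz s : 0 <= s -> mass k s <= z0.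
  by move=> s0; apply: le_trans (ih s s0); rewrite lerDl mulr_ge0// Y0.
have Yle : prim (mass4 k) t <= prim (mass4 k.+1) t.
  apply: (le_derive t0 (fun s => is_derive_prim s (c4 k))
    (fun s => is_derive_prim s (c4 k.+1))); first by rewrite !prim0.
  move=> s s0; apply: sum_level_le => u.
  by rewrite !mulr_ge0 ?expR_ge0 ?amp_ge0// exprn_ge0.
suff main : mass k.+1 t + (gam + (beta - 1) / 4) * prim (mass4 k.+1) t <=
    z0 + (beta - 1) / 4 * prim (mass4 k) t.
  have : (beta - 1) / 4 * prim (mass4 k) t <= (beta - 1) / 4 * prim (mass4 k.+1) t.
    by rewrite ler_wpM2l.
  by move: main; lra.
apply: (le_derive (f := fun t => mass k.+1 t + (gam + (beta - 1) / 4) * prim (mass4 k.+1) t)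
  (g := fun t => z0 + (beta - 1) / 4 * prim (mass4 k) t) t0
  (fun s => isdD (is_derive_mass k.+1 s) (isdZ _ (is_derive_prim s (c4 k.+1))))
  (fun s => isdD (isdC s z0) (isdZ _ (is_derive_prim s (c4 k))))).
  rewrite !prim0 !mulr0 !addr0; apply: le_trans (rho_sum k.+1).
  rewrite /mass; under eq_bigr do rewrite /weight mulr0 expR0.
  by rewrite sum_amp0; apply: ler_sum => j _; rewrite mul1r.
move=> s s0; rewrite add0r big_split /=.
apply: (@le_trans _ _ (0 + \sum_(u <- level k.+1) weight u s * source u s)).
  rewrite -addrA addrCA addrC lerD2r /mass4 mulr_sumr -big_split /=.
  rewrite -oppr_ge0 -sumrN; apply: sumr_ge0 => u _; rewrite oppr_ge0.
  have -> : weight u s * ((c + nu * `|fr u| - sigma u) * amp u s) +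
      (gam + (beta - 1) / 4) * (`|fr u| ^+ 4 * (weight u s * amp u s)) =
    weight u s * ((c + nu * `|fr u| - sigma u + (gam + (beta - 1) / 4) * `|fr u| ^+ 4) * amp u s).
    by ring.
  by rewrite mulr_ge0_le0 ?expR_ge0 ?damping.
by rewrite add0r; apply: sum_source => //; exact: mz.
Qed.

End estimate.
End amplitudes.

(** * The equation satisfied by finite levels *)

Lemma periodic_intmul {R : realType} (f : R -> R) (y : R) (m : int) :
  (forall y, f (y + pi *+ 2) = f y) -> f (y + m%:~R * (2 * pi)) = f y.
Proof.
move=> pf; case: m => n.
  elim: n => [|n ih]; first by rewrite mul0r addr0.
  rewrite -[in RHS]ih -[in RHS]pf; congr f.
  by rewrite -mulr_natl -addn1 PoszD intrD; ring.
rewrite NegzE; elim: n => [|n ih].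
  by rewrite -pf; congr f; rewrite -mulr_natl; ring.
rewrite -[in RHS]ih -[in LHS]pf; congr f.
by rewrite -mulr_natl -addn1 -[n.+1]addn1 !PoszD !intrN !intrD; ring.
Qed.

Section waves.
Context {R : realType}.
Local Notation mu := (@lebesgue_measure R).
Variables (eps beta : R) (rho theta : nat -> R).

Local Notation amp := (amp eps beta rho).
Local Notation source := (source eps beta rho).
Local Notation sigma := (@sigma R beta).
Local Notation coupling := (@coupling R eps beta).

Fixpoint phase (u : tree) : R :=
  match u with
  | Leaf j => theta j
  | Node s l r => phase r + (-1) ^+ s * phase l
  end.

(* The amplitudes [amp] are driven by the absolute value of the couplings; the signs,
   constant in time, are collected here. *)
Fixpoint sgn (u : tree) : R :=
  match u with
  | Leaf j => 1
  | Node s l r => Num.sg (coupling s l r) * (sgn l * sgn r)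
  end.

Lemma sgn_le1 u : `|sgn u| <= 1.
Proof.
elim: u => [j|s l hl r hr] /=; first by rewrite normr1.
rewrite !normrM mulr_ile1 ?mulr_ile1 ?mulr_ge0//.
by rewrite normr_sg; case: (_ != 0).
Qed.

(** Table of the [i]-th x-derivatives of a cosine wave. The last clause catches every [i >= 4],
    hence the restrictions on [i] below. *)
Definition wave (i : nat) (u : tree) (x : R) : R :=
  let y := fr u * x + phase u in
  match i with
  | 0 => cos y
  | 1 => - fr u * sin y
  | 2 => - fr u ^+ 2 * cos y
  | 3 => fr u ^+ 3 * sin y
  | _ => fr u ^+ 4 * cos y
  end.

Lemma wave_le i u x : (i <= 4)%N -> `|wave i u x| <= `|fr u| ^+ i.
Proof.
have c1 := cos_max (fr u * x + phase u); have s1 := sin_max (fr u * x + phase u).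
have key (a b : R) : `|b| <= 1 -> `|a * b| <= `|a|.
  by move=> h; rewrite normrM -[leRHS]mulr1 ler_wpM2l.
move: i => [|[|[|[|[|]]]]] //= _.
- by rewrite expr1 -[leRHS]normrN; exact: key.
- by rewrite -normrX -[leRHS]normrN; exact: key.
- by rewrite -normrX; exact: key.
- by rewrite -normrX; exact: key.
Qed.

Lemma is_derive_wave i u (x : R) : (i < 4)%N -> is_derive x 1 (wave i u) (wave i.+1 u x).
Proof.
have dc := @isd_lin R cos x (fr u) (phase u) _ (is_derive_cos _).
have ds := @isd_lin R sin x (fr u) (phase u) _ (is_derive_sin _).
move: i => [|[|[|[|]]]] // _.
- by apply: (isd_eq dc); rewrite /=; ring.
- by apply: (isd_eq (isdZ _ ds)); rewrite /=; ring.
- by apply: (isd_eq (isdZ _ dc)); rewrite /=; ring.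
- by apply: (isd_eq (isdZ _ ds)); rewrite /=; ring.
Qed.

Lemma continuous_wave i u : continuous (wave i u).
Proof.
have [i4|i4] := ltnP i 4.
  by apply: (@is_derive_continuous R _ (wave i.+1 u)) => t; exact: is_derive_wave.
have -> : wave i u = fun x => fr u ^+ 4 * cos (fr u * x + phase u).
  by move: i i4 => [|[|[|[|]]]].
by move=> x; apply: cvgM; [exact: cvg_cst|exact: continuous_cosl].
Qed.

Lemma wave_periodic i u x : wave i u (x + 2 * pi) = wave i u x.
Proof.
have e : fr u * (x + 2 * pi) + phase u = fr u * x + phase u + (freq u)%:~R * (2 * pi).
  by rewrite /fr; ring.
by move: i => [|[|[|[|]]]] /=; rewrite e ?(periodic_intmul _ _ (@cosD2pi R))
  ?(periodic_intmul _ _ (@sinD2pi R)).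
Qed.

Definition samp (u : tree) (t : R) : R := sgn u * amp u t.

Definition ssource (u : tree) (t : R) : R := sgn u * source u t.

Lemma is_derive_samp u (t : R) : is_derive t 1 (samp u) (- sigma u * samp u t + ssource u t).
Proof.
apply: (isd_eq (isdZ (sgn u) (is_derive_amp eps beta rho u t))).
by rewrite /samp /ssource; ring.
Qed.

(** Sign and modulus of the coupling recombine here: the signed amplitudes obey the true equation,
    the unsigned ones carry the estimates. *)
Lemma ssource_node s l r (t : R) :
  ssource (Node s l r) t = coupling s l r * (samp l t * samp r t).
Proof.
rewrite /ssource /samp /= {3}[coupling s l r]numEsg; ring.
Qed.

Definition wsum (a w : tree -> R -> R) (k : nat) (t x : R) : R :=
  \sum_(u <- level k) a u t * w u x.

Lemma continuous_wsum a w k : (forall u, continuous (a u)) -> (forall u, continuous (w u)) ->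
  continuous (fun p : R * R => wsum a w k p.1 p.2).
Proof.
move=> ca cw; rewrite /wsum; elim: (level k) => [|u s ih] p.
  by under eq_fun do rewrite big_nil; exact: cvg_cst.
under eq_fun do rewrite big_cons; apply: cvgD; last exact: ih.
apply: cvgM.
  by apply: (continuous_comp _ (ca u p.1)); exact: cvg_fst.
by apply: (continuous_comp _ (cw u p.2)); exact: cvg_snd.
Qed.

Definition zeta_ (i : nat) := wsum samp (wave i).

Definition dzeta := wsum (fun u t => - sigma u * samp u t + ssource u t) (wave 0).

Lemma is_derive_zeta_x i k (t x : R) : (i < 4)%N ->
  is_derive x 1 (zeta_ i k t) (zeta_ i.+1 k t x).
Proof. by move=> i4; apply: isd_sum => u; apply: isdZ; exact: is_derive_wave. Qed.

Lemma is_derive_zeta_t k (t x : R) : is_derive t 1 (zeta_ 0 k ^~ x) (dzeta k t x).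
Proof.
have := isd_sum (level k) (fun u => isdM (is_derive_samp u t) (isdC t (wave 0 u x))).
by move=> h; apply: (isd_eq h); apply: eq_bigr => u _; rewrite mulr0 addr0.
Qed.

(** The nodes of level [k.+1] are the pairs of trees of level [k], so their sources sum to a product
    of two level-[k] sums: left subtrees build [zeta], right ones [zeta_x + beta zeta_xxx]. The two
    signs merge by the addition formulas. *)
Lemma zeta_pde k (t x : R) : dzeta k.+1 t x =
  - (zeta_ 2 k.+1 t x + beta * zeta_ 4 k.+1 t x) -
  eps * (zeta_ 1 k t x * (zeta_ 1 k t x + beta * zeta_ 3 k t x) +
         zeta_ 0 k t x * (zeta_ 2 k t x + beta * zeta_ 4 k t x)).
Proof.
have -> : dzeta k.+1 t x =
    \sum_(u <- level k.+1) - sigma u * samp u t * wave 0 u x +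
    \sum_(u <- level k.+1) ssource u t * wave 0 u x.
  by rewrite -big_split; apply: eq_bigr => u _; rewrite /= mulrDl.
congr (_ + _).
  rewrite /zeta_ /wsum mulr_sumr -big_split -sumrN; apply: eq_bigr => u _.
  by rewrite /sigma /=; ring.
rewrite sum_level_succ [X in X + _]big1 ?add0r; last first.
  by move=> j _; rewrite /ssource /= mulr0 mul0r.
rewrite /zeta_ /wsum.
have mulsum (a b : tree -> R) : (\sum_(l <- level k) a l) * (\sum_(r <- level k) b r) =
    \sum_(l <- level k) \sum_(r <- level k) a l * b r.
  by rewrite mulr_suml; apply: eq_bigr => l _; rewrite mulr_sumr.
rewrite !(mulr_sumr _ _ _ beta) -!big_split !mulsum -big_split mulr_sumr -sumrN.
apply: eq_bigr => l _; rewrite -big_split mulr_sumr -sumrN; apply: eq_bigr => r _.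
rewrite !ssource_node /coupling /= !fr_node expr0 expr1.
have e1 : (fr r + 1 * fr l) * x + (phase r + 1 * phase l) =
  (fr r * x + phase r) + (fr l * x + phase l) by ring.
have e2 : (fr r + -1 * fr l) * x + (phase r + -1 * phase l) =
  (fr r * x + phase r) - (fr l * x + phase l) by ring.
by rewrite e1 e2 cosD cosB; field.
Qed.

Lemma continuous_samp u : continuous (samp u).
Proof. exact: is_derive_continuous (is_derive_samp u). Qed.

Lemma continuous_zeta i k : continuous (fun p : R * R => zeta_ i k p.1 p.2).
Proof. by apply: continuous_wsum; [exact: continuous_samp|exact: continuous_wave]. Qed.

Lemma continuous_dzeta k : continuous (fun p : R * R => dzeta k p.1 p.2).
Proof.
apply: continuous_wsum; last by move=> u; exact: continuous_wave.
move=> u t; apply: cvgD; first by apply: cvgM; [exact: cvg_cst|exact: continuous_samp].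
by apply: cvgM; [exact: cvg_cst|exact: continuous_source].
Qed.

Lemma zeta_periodic i k t x : zeta_ i k t (x + 2 * pi) = zeta_ i k t x.
Proof. by apply: eq_bigr => u _; rewrite wave_periodic. Qed.

(** The linear part lives one level above the product, which is the mismatch in [zeta_pde]; both
    levels have the same limit. *)
Definition flux (i k : nat) (t x : R) : R :=
  zeta_ i k.+1 t x + eps * zeta_ 0 k t x * zeta_ i k t x.

Lemma continuous_flux i k : continuous (fun p : R * R => flux i k p.1 p.2).
Proof.
move=> p; apply: cvgD; first exact: continuous_zeta.
apply: cvgM; last exact: continuous_zeta.
by apply: cvgM; [exact: cvg_cst|exact: continuous_zeta].
Qed.

Lemma flux_periodic i k t x : flux i k t (x + 2 * pi) = flux i k t x.
Proof. by rewrite /flux !zeta_periodic. Qed.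

(** * Weak form of the equation at a finite level *)

Section weak.
Variables (phi phit phix : R -> R -> R).
Hypothesis cphi : continuous (fun p : R * R => phi p.1 p.2).
Hypothesis cphit : continuous (fun p : R * R => phit p.1 p.2).
Hypothesis cphix : continuous (fun p : R * R => phix p.1 p.2).
Hypothesis dphit : forall t x : R, is_derive t 1 (phi ^~ x) (phit t x).
Hypothesis dphix : forall t x : R, is_derive x 1 (phi t) (phix t x).
Hypothesis phi_periodic : forall t x, phi t (x + 2 * pi) = phi t x.

Lemma continuous_mul2 (F G : R -> R -> R) :
  continuous (fun p : R * R => F p.1 p.2) -> continuous (fun p : R * R => G p.1 p.2) ->
  continuous (fun p : R * R => F p.1 p.2 * G p.1 p.2).
Proof. by move=> cF cG p; apply: cvgM; [exact: cF|exact: cG]. Qed.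

Lemma weak_level_x k (t : R) : intT (fun x => dzeta k.+1 t x * phi t x) =
  intT (fun x => flux 1 k t x * phix t x) + beta * intT (fun x => flux 3 k t x * phix t x).
Proof.
pose Q x := flux 1 k t x + beta * flux 3 k t x.
have L1 i : L1T (fun x => flux i k t x * phix t x).
  apply: continuous_L1T.
  exact: (@continuous_section2 R (fun s x => flux i k s x * phix s x) t
    (continuous_mul2 (@continuous_flux i k) cphix)).
have dQ (x : R) : is_derive x 1 Q (- dzeta k.+1 t x).
  have d i := is_derive_zeta_x k t x (i := i).
  have d' i := is_derive_zeta_x k.+1 t x (i := i).
  apply: (isd_eq (isdD (isdD (d' 1 isT) (isdM (isdZ eps (d 0 isT)) (d 1 isT)))
    (isdZ beta (isdD (d' 3 isT) (isdM (isdZ eps (d 0 isT)) (d 3 isT)))))).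
  by rewrite zeta_pde; ring.
rewrite -intTZ// -intTD//; last exact: L1TZ.
have -> : intT (fun x => flux 1 k t x * phix t x + beta * (flux 3 k t x * phix t x)) =
    intT (fun x => Q x * phix t x).
  by apply: eq_Rintegral => x _; rewrite /Q; ring.
have cd := @continuous_section2 R (dzeta k.+1) t (@continuous_dzeta k.+1).
have cx := @continuous_section2 R phix t cphix.
have cp := @continuous_section2 R phi t cphi.
rewrite (intT_by_parts dQ (dphix t) _ cx).
- rewrite -intTN; last first.
    by apply: continuous_L1T => x; apply: cvgM; [apply: cvgN; exact: cd|exact: cp].
  by apply: eq_Rintegral => x _; rewrite mulNr opprK.
- by move=> x; apply: cvgN; exact: cd.
- by rewrite -[2 * pi]add0r /Q !flux_periodic phi_periodic.
Qed.

(** Integrates in time the derivative of the pairing with [phi]; finite sums are smooth up to time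
    zero, so no limit is involved yet. *)
Lemma weak_level k (t : R) : 0 <= t ->
  intT (fun x => zeta_ 0 k.+1 t x * phi t x) - intT (fun x => zeta_ 0 k.+1 0 x * phi 0 x)
  - \int[mu]_(s in `[0%R, t]) intT (fun x => zeta_ 0 k.+1 s x * phit s x) =
  \int[mu]_(s in `[0%R, t]) intT (fun x => flux 1 k s x * phix s x) +
  beta * \int[mu]_(s in `[0%R, t]) intT (fun x => flux 3 k s x * phix s x).
Proof.
move=> t0.
have cI F : continuous (fun p : R * R => F p.1 p.2) ->
    mu.-integrable `[0, t] (EFin \o (fun s => intT (F s))).
  by move=> cF; apply: continuous_itv_integrable; exact: continuous_intT.
have cz := @continuous_zeta 0 k.+1.
have cd := @continuous_dzeta k.+1.
have c1 := continuous_mul2 (@continuous_flux 1 k) cphix.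
have c3 := continuous_mul2 (@continuous_flux 3 k) cphix.
have ct := continuous_mul2 cz cphit.
have cp := continuous_mul2 cd cphi.
pose dF s x := dzeta k.+1 s x * phi s x + zeta_ 0 k.+1 s x * phit s x.
have cdF : continuous (fun p : R * R => dF p.1 p.2).
  by move=> p; apply: cvgD; [exact: cp|exact: ct].
have dI (s : R) := @is_derive_intT R (fun s x => zeta_ 0 k.+1 s x * phi s x) dF s
  (continuous_mul2 cz cphi) cdF (fun s x => isdM (is_derive_zeta_t k.+1 s x) (dphit s x)).
rewrite -(Rintegral_FTC2 t0 dI (continuous_intT cdF)).
have -> : \int[mu]_(x in `[0, t]) intT (dF x) =
    \int[mu]_(s in `[0, t]) (intT (fun x => flux 1 k s x * phix s x) +
      beta * intT (fun x => flux 3 k s x * phix s x) +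
      intT (fun x => zeta_ 0 k.+1 s x * phit s x)).
  apply: eq_Rintegral => s _; rewrite -weak_level_x -intTD//.
  - exact/continuous_L1T/(@continuous_section2 R (fun s x => dzeta k.+1 s x * phi s x) s cp).
  - exact/continuous_L1T/(@continuous_section2 R (fun s x => zeta_ 0 k.+1 s x * phit s x) s ct).
have mt : measurable (`[0, t]%classic : set R) by exact: measurable_itv.
have i1 := cI (fun s x => flux 1 k s x * phix s x) c1.
have i3 := cI (fun s x => flux 3 k s x * phix s x) c3.
have it := cI (fun s x => zeta_ 0 k.+1 s x * phit s x) ct.
have i3' : mu.-integrable `[0, t]
    (EFin \o (fun s : R => beta * intT (fun x => flux 3 k s x * phix s x))).
  by have := @integrableZl _ _ _ mu _ mt beta _ i3; apply.
have i13 := @integrableD _ _ _ mu _ mt _ _ i1 i3'.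
rewrite (@RintegralD _ _ _ mu _ _ _ mt i13 it) addrK.
by rewrite (@RintegralD _ _ _ mu _ _ _ mt i1 i3') (@RintegralZl _ _ _ mu _ _ beta mt i3).
Qed.

End weak.
End waves.

(** * Fourier coefficients of sums of waves *)

Section planar_norm.
Context {R : realType}.

Definition norm2 (a b : R) : R := Num.sqrt (a ^+ 2 + b ^+ 2).

Lemma norm2_ge0 a b : 0 <= norm2 a b.
Proof. exact: sqrtr_ge0. Qed.

Lemma sqr_norm2 a b : norm2 a b ^+ 2 = a ^+ 2 + b ^+ 2.
Proof. by rewrite sqr_sqrtr// addr_ge0// sqr_ge0. Qed.

Lemma norm2_le a b c : 0 <= c -> a ^+ 2 + b ^+ 2 <= c ^+ 2 -> norm2 a b <= c.
Proof. by move=> c0 h; rewrite -(ler_sqr (norm2_ge0 _ _) c0)//= sqr_norm2. Qed.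

Lemma norm2Z k a b : norm2 (k * a) (k * b) = `|k| * norm2 a b.
Proof. by rewrite /norm2 !exprMn -mulrDr sqrtrM ?sqr_ge0// sqrtr_sqr. Qed.

Lemma norm2D a b c d : norm2 (a + c) (b + d) <= norm2 a b + norm2 c d.
Proof.
apply: norm2_le; first by rewrite addr_ge0 ?norm2_ge0.
rewrite !sqrrD !sqr_norm2.
have h : a * c + b * d <= norm2 a b * norm2 c d.
  apply: (le_trans (ler_norm _)); rewrite -ler_sqr ?nnegrE ?mulr_ge0 ?norm2_ge0//.
  rewrite exprMn !sqr_norm2 real_normK ?num_real// -subr_ge0.
  have -> : (a ^+ 2 + b ^+ 2) * (c ^+ 2 + d ^+ 2) - (a * c + b * d) ^+ 2 = (a * d - b * c) ^+ 2.
    by ring.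
  exact: sqr_ge0.
rewrite !mulr2n; lra.
Qed.

Lemma norm2_sum (I : Type) (s : seq I) (k a b : I -> R) :
  norm2 (\sum_(i <- s) k i * a i) (\sum_(i <- s) k i * b i) <=
  \sum_(i <- s) `|k i| * norm2 (a i) (b i).
Proof.
elim: s => [|i s ih]; first by rewrite !big_nil /norm2 expr0n /= addr0 sqrtr0.
by rewrite !big_cons (le_trans (norm2D _ _ _ _))// norm2Z lerD2l.
Qed.

End planar_norm.

Section fourier.
Context {R : realType}.
Local Notation mu := (@lebesgue_measure R).
Local Notation torus := (@torus R).

Lemma fourier_absE (f : R -> R) (n : int) :
  fourier_abs f n = norm2 (fourier_re f n) (fourier_im f n).
Proof. by []. Qed.

Lemma fourier_abs_ge0 (f : R -> R) n : 0 <= fourier_abs f n.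
Proof. exact: norm2_ge0. Qed.

Lemma continuous_cosf (p : int) : continuous (fun x : R => cos (p%:~R * x)).
Proof. by have := @continuous_cosl R p%:~R 0; under eq_fun do rewrite addr0. Qed.

Lemma continuous_sinf (p : int) : continuous (fun x : R => sin (p%:~R * x)).
Proof. by have := @continuous_sinl R p%:~R 0; under eq_fun do rewrite addr0. Qed.

Lemma fourier_absN (f : R -> R) n : L1T f -> fourier_abs f (- n) = fourier_abs f n.
Proof.
move=> fL; have hr : fourier_re f (- n) = fourier_re f n.
  by congr (_ * _); apply: eq_Rintegral => x _; rewrite intrN mulNr cosN.
have hi : fourier_im f (- n) = - fourier_im f n.
  have e : intT (fun x => f x * sin ((- n)%:~R * x)) = - intT (fun x => f x * sin (n%:~R * x)).
    rewrite -intTN; last exact/L1TM/continuous_sinf.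
    by apply: eq_Rintegral => x _; rewrite intrN mulNr sinN mulrN.
  by rewrite /fourier_im e mulrN.
by rewrite /fourier_abs hr hi sqrrN.
Qed.

Lemma intT_cos_freq (q : int) (a : R) :
  intT (fun x => cos (q%:~R * x + a)) = 2 * pi * cos a * (q == 0)%:R.
Proof.
have [->|q0] := eqVneq q 0.
  rewrite mulr1 mulrC -intT_cst; apply: eq_Rintegral => x _.
  by rewrite mul0r add0r.
have qR : q%:~R != 0 :> R by rewrite intr_eq0.
have pi2 : 0 <= 2 * pi :> R by rewrite mulr_ge0 ?pi_ge0.
have d (x : R) : is_derive x 1 (fun x => q%:~R^-1 * sin (q%:~R * x + a)) (cos (q%:~R * x + a)).
  by apply: (isd_eq (isdZ _ (@isd_lin R sin x _ a _ (is_derive_sin _)))); rewrite mulKf.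
rewrite mulr0 /intT (Rintegral_FTC2 pi2 d); last exact: continuous_cosl.
have -> : q%:~R * (2 * pi) + a = a + q%:~R * (2 * pi) by rewrite addrC.
by rewrite (periodic_intmul _ _ (@sinD2pi R)) mulr0 add0r subrr.
Qed.

Lemma intT_sin_freq (q : int) (a : R) :
  intT (fun x => sin (q%:~R * x + a)) = 2 * pi * sin a * (q == 0)%:R.
Proof.
have -> : intT (fun x => sin (q%:~R * x + a)) = intT (fun x => cos (q%:~R * x + (a - pi / 2))).
  by apply: eq_Rintegral => x _; rewrite addrA cosBpihalf.
by rewrite intT_cos_freq cosBpihalf.
Qed.

Variable theta : nat -> R.

Lemma fourier_re_wave u (p : int) : fourier_re (wave theta 0 u) p =
  2^-1 * cos (phase theta u) * ((freq u == p)%:R + (freq u == - p)%:R).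
Proof.
rewrite /fourier_re.
have cc q : L1T (fun x : R => cos (q%:~R * x + phase theta u)).
  by apply: continuous_L1T; exact: continuous_cosl.
have -> : intT (fun x => wave theta 0 u x * cos (p%:~R * x)) =
    intT (fun x => 2^-1 * cos ((freq u + p)%:~R * x + phase theta u) +
                   2^-1 * cos ((freq u - p)%:~R * x + phase theta u)).
  apply: eq_Rintegral => x _; rewrite /wave /= /fr intrD intrB.
  set y := (freq u)%:~R * x + phase theta u.
  have -> : ((freq u)%:~R + p%:~R) * x + phase theta u = y + p%:~R * x by rewrite /y; ring.
  have -> : ((freq u)%:~R - p%:~R) * x + phase theta u = y - p%:~R * x by rewrite /y; ring.
  by rewrite (cosD y) (cosB y); field.
rewrite intTD ?intTZ; try by [exact: cc|exact/L1TZ/cc].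
rewrite !intT_cos_freq addr_eq0 subr_eq0.
by move: (pi : R) (lt0r_neq0 (pi_gt0 R)) => P P0; field.
Qed.

Lemma fourier_im_wave u (p : int) : fourier_im (wave theta 0 u) p =
  2^-1 * sin (phase theta u) * ((freq u == p)%:R - (freq u == - p)%:R).
Proof.
rewrite /fourier_im.
have cc q : L1T (fun x : R => sin (q%:~R * x + phase theta u)).
  by apply: continuous_L1T; exact: continuous_sinl.
have -> : intT (fun x => wave theta 0 u x * sin (p%:~R * x)) =
    intT (fun x => 2^-1 * sin ((freq u + p)%:~R * x + phase theta u) +
                   - 2^-1 * sin ((freq u - p)%:~R * x + phase theta u)).
  apply: eq_Rintegral => x _; rewrite /wave /= /fr intrD intrB.
  set y := (freq u)%:~R * x + phase theta u.
  have -> : ((freq u)%:~R + p%:~R) * x + phase theta u = y + p%:~R * x by rewrite /y; ring.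
  have -> : ((freq u)%:~R - p%:~R) * x + phase theta u = y - p%:~R * x by rewrite /y; ring.
  by rewrite (sinD y) (sinB y); field.
rewrite intTD ?intTZ; try by [exact: cc|exact/L1TZ/cc].
rewrite !intT_sin_freq addr_eq0 subr_eq0.
by move: (pi : R) (lt0r_neq0 (pi_gt0 R)) => P P0; field.
Qed.

(** Equality holds unless both indicators are 1, which happens only for [freq u = p = 0]; there the
    constant wave loses the sine of its phase. *)
Lemma fourier_abs_wave u (p : int) : fourier_abs (wave theta 0 u) p <=
  2^-1 * ((freq u == p)%:R + (freq u == - p)%:R).
Proof.
rewrite fourier_absE fourier_re_wave fourier_im_wave.
have := cos2Dsin2 (phase theta u).
set a : R := (_ == p)%:R; set b : R := (_ == - p)%:R => cs.
have a0 : 0 <= a by rewrite ler0n. have b0 : 0 <= b by rewrite ler0n.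
apply: norm2_le; first by rewrite mulr_ge0 ?addr_ge0.
rewrite -subr_ge0.
have -> : (2^-1 * (a + b)) ^+ 2 - ((2^-1 * cos (phase theta u) * (a + b)) ^+ 2 +
    (2^-1 * sin (phase theta u) * (a - b)) ^+ 2) =
  sin (phase theta u) ^+ 2 * (a * b) + 4^-1 * (a + b) ^+ 2 *
    (1 - (cos (phase theta u) ^+ 2 + sin (phase theta u) ^+ 2)) by field.
rewrite cs subrr mulr0 addr0; apply: mulr_ge0; [exact: sqr_ge0|exact: mulr_ge0].
Qed.

Lemma L1T_sum (I : Type) (s : seq I) (f : I -> R -> R) : (forall i, L1T (f i)) ->
  L1T (fun x => \sum_(i <- s) f i x).
Proof.
move=> fL; elim: s => [|i s ih].
  by under eq_fun do rewrite big_nil; apply: continuous_L1T => x; exact: cvg_cst.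
by under eq_fun do rewrite big_cons; exact: L1TD.
Qed.

Lemma intT_sum (I : Type) (s : seq I) (f : I -> R -> R) : (forall i, L1T (f i)) ->
  intT (fun x => \sum_(i <- s) f i x) = \sum_(i <- s) intT (f i).
Proof.
move=> fL; elim: s => [|i s ih].
  by rewrite big_nil -[RHS](mul0r (2 * pi)) -intT_cst; apply: eq_Rintegral => x _; rewrite big_nil.
rewrite big_cons -ih -intTD//; last exact: L1T_sum.
by apply: eq_Rintegral => x _; rewrite big_cons.
Qed.

Lemma intT_wave_sum (a : tree -> R) (g : R -> R) k : continuous g ->
  intT (fun x => (\sum_(u <- level k) a u * wave theta 0 u x) * g x) =
  \sum_(u <- level k) a u * intT (fun x => wave theta 0 u x * g x).
Proof.
move=> cg.
have wL u : L1T (fun x => wave theta 0 u x * g x).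
  by apply: L1TM => //; apply: continuous_L1T; exact: continuous_wave.
have -> : \sum_(u <- level k) a u * intT (fun x => wave theta 0 u x * g x) =
    \sum_(u <- level k) intT (fun x => a u * (wave theta 0 u x * g x)).
  by apply: eq_bigr => u _; rewrite intTZ.
rewrite -intT_sum; last by move=> u; exact: L1TZ.
by apply: eq_Rintegral => x _; rewrite mulr_suml; apply: eq_bigr => u _; rewrite mulrA.
Qed.

Lemma fourier_re_wave_sum (a : tree -> R) k (p : int) :
  fourier_re (fun x => \sum_(u <- level k) a u * wave theta 0 u x) p =
  \sum_(u <- level k) a u * fourier_re (wave theta 0 u) p.
Proof.
rewrite /fourier_re intT_wave_sum; last exact: continuous_cosf.
by rewrite mulr_sumr; apply: eq_bigr => u _; rewrite mulrCA.
Qed.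

Lemma fourier_im_wave_sum (a : tree -> R) k (p : int) :
  fourier_im (fun x => \sum_(u <- level k) a u * wave theta 0 u x) p =
  \sum_(u <- level k) a u * fourier_im (wave theta 0 u) p.
Proof.
rewrite /fourier_im intT_wave_sum; last exact: continuous_sinf.
by rewrite mulr_sumr -sumrN; apply: eq_bigr => u _; rewrite mulrN mulrCA.
Qed.

Lemma fourier_abs_wave_sum (a : tree -> R) k (p : int) :
  fourier_abs (fun x => \sum_(u <- level k) a u * wave theta 0 u x) p <=
  \sum_(u <- level k) `|a u| * (2^-1 * ((freq u == p)%:R + (freq u == - p)%:R)).
Proof.
rewrite fourier_absE fourier_re_wave_sum fourier_im_wave_sum.
apply: (le_trans (norm2_sum _ _ _ _)); apply: ler_sum => u _.
by rewrite ler_wpM2l//; exact: fourier_abs_wave.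
Qed.

(** A wave puts at most half of its amplitude on each of its two opposite frequencies, and [w] is
    even, so it pays at most [w (freq u)] in all. This passes from Wiener norms to sums over trees
    with constant 1. *)
Lemma weighted_fourier_abs_wave_sum (a : tree -> R) k (w : int -> R) (s : seq int) :
  uniq s -> (forall p, 0 <= w p) -> (forall p, w (- p) = w p) ->
  \sum_(p <- s) w p * fourier_abs (fun x => \sum_(u <- level k) a u * wave theta 0 u x) p <=
  \sum_(u <- level k) w (freq u) * `|a u|.
Proof.
move=> us w0 wN.
apply: (@le_trans _ _ (\sum_(p <- s) w p * \sum_(u <- level k) `|a u| *
    (2^-1 * ((freq u == p)%:R + (freq u == - p)%:R)))).
  by apply: ler_sum => p _; rewrite ler_wpM2l//; exact: fourier_abs_wave_sum.
under eq_bigr do rewrite mulr_sumr.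
rewrite exchange_big; apply: ler_sum => u _ /=.
have one (q : int) : \sum_(p <- s) w p * (q == p)%:R <= w q.
  have [qs|qs] := boolP (q \in s).
    rewrite (bigD1_seq q)//= eqxx mulr1 big1 ?addr0// => p pq.
    by rewrite eq_sym (negbTE pq) mulr0.
  rewrite big_seq big1 ?w0// => p ps; case: eqP => [qp|_]; last by rewrite mulr0.
  by rewrite qp ps in qs.
have -> : \sum_(p <- s) w p * (`|a u| * (2^-1 * ((freq u == p)%:R + (freq u == - p)%:R))) =
    2^-1 * `|a u| * (\sum_(p <- s) w p * (freq u == p)%:R +
      \sum_(p <- s) w p * (- freq u == p)%:R).
  rewrite -big_split mulr_sumr; apply: eq_bigr => p _ /=.
  by rewrite eqr_oppLR; ring.
have h1 := one (freq u). have h2 := one (- freq u); rewrite wN in h2.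
apply: (@le_trans _ _ (2^-1 * `|a u| * (w (freq u) + w (freq u)))).
  by rewrite ler_wpM2l ?mulr_ge0// lerD.
by rewrite le_eqVlt; apply/orP; left; apply/eqP; field.
Qed.

End fourier.

(** * Passage to the limit *)

(** The integral of a nonnegative function is a supremum over simple functions below it, hence
    monotone in general. This avoids proving that the Wiener norm of the solution is measurable in
    time. *)
Lemma ge0_le_integral_nonmeasurable d (T : measurableType d) (R : realType)
    (mu : {measure set T -> \bar R}) (D : set T) (f g : T -> \bar R) :
  (forall x, D x -> 0 <= f x)%E -> (forall x, D x -> f x <= g x)%E ->
  (\int[mu]_(x in D) f x <= \int[mu]_(x in D) g x)%E.
Proof.
move=> f0 fg; rewrite [leLHS]integral_mkcond [leRHS]integral_mkcond.
have g0 x : D x -> (0 <= g x)%E by move=> Dx; apply: le_trans (fg x Dx); exact: f0.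
have f0' x : (0 <= (f \_ D) x)%E by rewrite patchE; case: ifPn => // /set_mem/f0.
have g0' x : (0 <= (g \_ D) x)%E by rewrite patchE; case: ifPn => // /set_mem/g0.
rewrite !ge0_integralTE//; apply: ereal_sup_le => _ [h /= hf <-]; exists h => //= x.
apply: (le_trans (hf x)); rewrite !patchE; case: ifPn => // /set_mem; exact: fg.
Qed.

Section level_limits.
Context {R : realType}.

Lemma nd_sum_level (f : tree -> R) : (forall u, 0 <= f u) ->
  nondecreasing_seq (fun k => \sum_(u <- level k) f u).
Proof. by move=> f0 k m km; exact: sum_level_homo. Qed.

Lemma cvg_nd_bounded (s : nat -> R) M : nondecreasing_seq s -> (forall k, s k <= M) -> cvgn s.
Proof.
by move=> nd sM; apply: nondecreasing_is_cvgn => //; exists M => _ [k _ <-].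
Qed.

(** [f] is the difference of [|f| + f] and [|f|], whose level sums are nondecreasing and bounded. *)
Lemma is_cvg_sum_level (f : tree -> R) M :
  (forall k, \sum_(u <- level k) `|f u| <= M) -> cvgn (fun k => \sum_(u <- level k) f u).
Proof.
move=> fM.
have h u : 0 <= `|f u| + f u by have := ler_norm (- f u); rewrite normrN; lra.
have -> : (fun k => \sum_(u <- level k) f u) =
    (fun k => \sum_(u <- level k) (`|f u| + f u) - \sum_(u <- level k) `|f u|).
  by apply/funext => k; rewrite big_split /= addrAC subrr add0r.
apply: is_cvgB; apply: (@cvg_nd_bounded _ (M + M)) => //.
- exact: nd_sum_level.
- move=> k; rewrite big_split /= lerD// (le_trans _ (fM k))//; apply: ler_sum => u _.
  exact: ler_norm.
- by apply: nd_sum_level.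
- move=> k; have := fM k; have : 0 <= \sum_(u <- level k) `|f u| by exact: sumr_ge0.
  lra.
Qed.

End level_limits.

Section limits.
Context {R : realType}.
Local Notation mu := (@lebesgue_measure R).
Local Notation torus := (@torus R).
Variables (eps beta z0 : R) (rho theta : nat -> R).
Hypothesis rho_ge0 : forall j, 0 <= rho j.
Hypothesis rho0 : rho 0 = 0.
Hypothesis eps0 : 0 < eps.
Hypothesis beta1 : 1 < beta.
Hypothesis rho_sum : forall k, \sum_(j <- iota 0 k) rho j <= z0.
Hypothesis small : 8 * eps * (beta + 1) * z0 <= beta - 1.

Local Notation amp := (amp eps beta rho).
Local Notation samp := (samp eps beta rho).
Local Notation zeta_ := (zeta_ eps beta rho theta).
Local Notation flux := (flux eps beta rho theta).
Local Notation mass := (mass eps beta rho).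
Local Notation mass4 := (mass4 eps beta rho).

(** The share of the dissipation left after the strip and the quadratic term, to be split between
    [gam] and [c]. *)
Definition gamma : R := (beta - 1) / 4.

Lemma gamma_gt0 : 0 < gamma.
Proof. by rewrite divr_gt0// subr_gt0. Qed.

Lemma admissible_mass_bound (nu c gam : R) k (t : R) :
  0 <= nu <= (beta - 1) / 2 -> 0 <= c -> 0 <= gam -> gam + c <= gamma -> 0 <= t ->
  mass nu c k t + gam * prim (mass4 nu c k) t <= z0.
Proof.
move=> /andP[nu0 nub] c0 gam0; rewrite /gamma => gc t0.
by apply: mass_bound => //; lra.
Qed.

Lemma mass_le (nu c : R) k (t : R) :
  0 <= nu <= (beta - 1) / 2 -> 0 <= c <= gamma -> 0 <= t -> mass nu c k t <= z0.
Proof.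
move=> nub /andP[c0 cg] t0.
have := @admissible_mass_bound nu c 0 k t nub c0 (lexx _).
by rewrite add0r mul0r addr0; apply.
Qed.

Lemma weight00 u (t : R) : weight 0 0 u t = 1.
Proof. by rewrite /weight mul0r addr0 mul0r expR0. Qed.

Lemma mass00 k t : mass 0 0 k t = \sum_(u <- level k) amp u t.
Proof. by apply: eq_bigr => u _; rewrite weight00 mul1r. Qed.

Lemma mass400 k t : mass4 0 0 k t = \sum_(u <- level k) `|fr u| ^+ 4 * amp u t.
Proof. by apply: eq_bigr => u _; rewrite weight00 mul1r. Qed.

Lemma zero_bounds : (0 : R) <= 0 <= (beta - 1) / 2 /\ (0 : R) <= 0 <= gamma.
Proof. by rewrite lexx /= (ltW gamma_gt0) divr_ge0// subr_ge0 ltW. Qed.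

Lemma nd_mass nu c (t : R) : 0 <= t -> nondecreasing_seq (mass nu c ^~ t).
Proof.
move=> t0; apply: nd_sum_level => u.
by rewrite !mulr_ge0 ?expR_ge0 ?amp_ge0.
Qed.

Lemma nd_mass4 nu c (t : R) : 0 <= t -> nondecreasing_seq (mass4 nu c ^~ t).
Proof.
move=> t0; apply: nd_sum_level => u.
by rewrite !mulr_ge0 ?expR_ge0 ?amp_ge0// exprn_ge0.
Qed.

(* For [t > 0] the exponential weights absorb the four derivatives. *)
Lemma mass4_bounded (t : R) : 0 < t -> exists M, forall k, mass4 0 0 k t <= M.
Proof.
move=> t0; pose nu := (beta - 1) / 2.
have nu0 : 0 < nu by rewrite divr_gt0// subr_gt0.
(* From [expR y >= y^4 / 4!] with [y = nu |n| t]. *)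
exists (24 / (nu * t) ^+ 4 * z0) => k.
have nt : 0 < nu * t by rewrite mulr_gt0.
have h : mass nu 0 k t <= z0.
  by apply: mass_le; rewrite ?lexx ?(ltW nu0) ?(ltW t0)//= (ltW gamma_gt0).
apply: (@le_trans _ _ (24 / (nu * t) ^+ 4 * mass nu 0 k t)); last first.
  by rewrite ler_wpM2l// divr_ge0// exprn_ge0// ltW.
rewrite /mass mulr_sumr mass400; apply: ler_sum => u _.
rewrite mulrA ler_wpM2r ?amp_ge0 ?(ltW t0)//.
rewrite mulrAC ler_pdivlMr ?exprn_gt0// -exprMn /weight add0r.
have y0 : 0 <= nu * `|fr u| * t.
  by apply: mulr_ge0; [apply: mulr_ge0 => //; exact: ltW|exact: ltW].
have := expR_ge1Dxn 3 y0.
rewrite (_ : nu * `|fr u| * t = `|fr u| * (nu * t)); last by ring.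
rewrite (_ : 4`!%:R = 24 :> R)//; lra.
Qed.

(** One majorant serves all derivatives up to order four: nonzero frequencies satisfy
    [|n|^i <= n^4], and zero-frequency trees vanish. *)
Lemma zeta_le i k (t x : R) : (i <= 4)%N -> 0 <= t ->
  \sum_(u <- level k) `|samp u t * wave theta i u x| <= mass4 0 0 k t.
Proof.
move=> i4 t0; rewrite mass400; apply: ler_sum => u _.
have [u0|u0] := eqVneq (freq u) 0.
  by rewrite /samp amp_freq0// !mulr0 mul0r normr0.
rewrite normrM mulrC; apply: ler_pM => //.
  apply: (le_trans (wave_le _ _ _ i4)).
  by apply: ler_weXn2l => //; exact: fr_neq0.
rewrite normrM (ger0_norm (amp_ge0 _ _ _ _ _))// -[leRHS]mul1r ler_wpM2r ?amp_ge0//.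
exact: sgn_le1.
Qed.

Lemma zeta0_le k (t x : R) : 0 <= t ->
  \sum_(u <- level k) `|samp u t * wave theta 0 u x| <= z0.
Proof.
move=> t0; have [b1 b2] := zero_bounds.
apply: le_trans (mass_le k b1 b2 t0); rewrite mass00; apply: ler_sum => u _.
rewrite normrM -[leRHS]mulr1; apply: ler_pM => //.
  rewrite normrM (ger0_norm (amp_ge0 _ _ _ _ _))// -[leRHS]mul1r ler_wpM2r ?amp_ge0//.
  exact: sgn_le1.
by apply: (le_trans (wave_le _ _ _ (leq0n _))); rewrite expr0.
Qed.

(* The derivatives are only summable for [t > 0], and the amplitudes are only
   controlled for [t >= 0]. *)
Definition zcut (i k : nat) (t x : R) : R :=
  zeta_ i k (Num.max t 0) x * ((i == 0%N) || (0 < t))%:R.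

Definition zlim (i : nat) (t x : R) : R := limn (fun k => zcut i k t x).

Lemma zcut_gt0 i k t x : 0 < t -> zcut i k t x = zeta_ i k t x.
Proof. by move=> t0; rewrite /zcut t0 orbT mulr1 max_l// ltW. Qed.

Lemma zcut_ge0 k t x : 0 <= t -> zcut 0 k t x = zeta_ 0 k t x.
Proof. by move=> t0; rewrite /zcut eqxx mulr1 max_l. Qed.

Lemma zcut_cvg i t x : (i <= 4)%N -> (fun k => zcut i k t x) @ \oo --> zlim i t x.
Proof.
move=> i4.
suff : cvgn (fun k => zcut i k t x) by [].
rewrite /zcut; have [i0|i0] := eqVneq i 0%N.
  under eq_fun do rewrite mulr1; rewrite i0.
  apply: is_cvg_sum_level => k; apply: zeta0_le.
  by rewrite le_max lexx orbT.
have [t0|t0] := ltP 0 t; last first.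
  by under eq_fun do rewrite mulr0; exact: is_cvg_cst.
under eq_fun do rewrite mulr1.
have [M hM] := mass4_bounded t0.
by apply: (@is_cvg_sum_level _ _ M) => k; apply: le_trans (hM k); exact/zeta_le/ltW.
Qed.

Lemma continuous_clip : continuous (fun t : R => Num.max t 0).
Proof. by move=> t; apply: continuous_max; [exact: cvg_id|exact: cvg_cst]. Qed.

Lemma measurable_pos : measurable_fun setT (fun t : R => (0 < t)%R%:R : R).
Proof.
rewrite (_ : (fun t : R => (0 < t)%R%:R) = \1_(`]0, +oo[%classic : set R)); first exact: measurable_indic.
by apply/funext => t; rewrite indicE; congr (nat_of_bool _)%:R; apply/idP/idP;
  rewrite inE /= in_itv /= andbT.
Qed.

Lemma jmeas_zcut i k : jmeas (zcut i k).
Proof.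
apply: measurable_funM.
  rewrite /zeta_ /wsum; elim: (level k) => [|u s ih].
    by under eq_fun do rewrite big_nil; exact: measurable_cst.
  under eq_fun do rewrite big_cons; apply: measurable_funD => //.
  apply: measurable_funM.
    apply: (@measurableT_comp _ _ _ _ _ _ (fun t : R => samp u (Num.max t 0)) _ fst) => //.
    apply: continuous_measurable_fun => t.
    apply: (@continuous_comp _ _ _ (fun t : R => Num.max t 0) (samp u)).
      exact: continuous_clip.
    exact: continuous_samp.
  apply: (@measurableT_comp _ _ _ _ _ _ (wave theta i u) _ snd) => //.
  by apply: continuous_measurable_fun; exact: continuous_wave.
case: (i == 0%N) => /=; first exact: measurable_cst.
exact: (measurableT_comp measurable_pos measurable_fst).
Qed.

(** Thanks to the cut the sequence converges at every point of the plane, so joint measurability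
    passes to the limit with no exceptional set. *)
Lemma jmeas_zlim i : (i <= 4)%N -> jmeas (zlim i).
Proof.
move=> i4; apply: (@measurable_fun_cvg _ _ _ _ (fun k p => zcut i k p.1 p.2)).
  by move=> k; exact: jmeas_zcut.
by move=> p _; exact: zcut_cvg.
Qed.

Lemma measurable_section (F : R -> R -> R) (t : R) (D : set R) : jmeas F ->
  measurable D -> measurable_fun D (F t).
Proof.
move=> mF mD; apply: measurable_funTS.
exact: (measurableT_comp mF (pair1_measurable t)).
Qed.

(** The dominating function in time. It is finite for [t > 0] by [mass4_bounded] and is set to 0
    elsewhere, where the masses are not known to be bounded. *)
Definition gmaj (t : R) : R := limn (fun k => mass4 0 0 k t * (0 < t)%R%:R).

Lemma gmaj_cvg t : (fun k => mass4 0 0 k t * (0 < t)%R%:R) @ \oo --> gmaj t.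
Proof.
suff : cvgn (fun k => mass4 0 0 k t * (0 < t)%R%:R) by [].
have [t0|t0] := ltP 0 t; last first.
  by under eq_fun do rewrite mulr0; exact: is_cvg_cst.
under eq_fun do rewrite mulr1.
have [M hM] := mass4_bounded t0.
by apply: (@cvg_nd_bounded _ _ M) => //; apply: nd_mass4; exact: ltW.
Qed.

Lemma measurable_gmaj : measurable_fun setT gmaj.
Proof.
apply: (@measurable_fun_cvg _ _ _ _ (fun k t => mass4 0 0 k t * (0 < t)%R%:R)).
  move=> k; apply: measurable_funM; last exact: measurable_pos.
  by apply: continuous_measurable_fun; exact: continuous_mass4.
by move=> t _; exact: gmaj_cvg.
Qed.

Lemma mass4_le_gmaj k (t : R) : 0 < t -> mass4 0 0 k t <= gmaj t.
Proof.
move=> t0; have := @gmaj_cvg t; rewrite t0; under eq_fun do rewrite mulr1.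
move=> h; rewrite -(cvg_lim (@Rhausdorff R) h); apply: nondecreasing_cvgn_le.
  by apply: nd_mass4; exact: ltW.
by apply/cvg_ex; exists (gmaj t).
Qed.

Lemma gmaj_ge0 t : 0 <= gmaj t.
Proof.
have [t0|t0] := ltP 0 t.
  by apply: le_trans (mass4_le_gmaj 0 t0); apply: mass4_ge0 => //; exact: ltW.
by rewrite /gmaj ltNge t0 /=; under eq_fun do rewrite mulr0; rewrite lim_cst.
Qed.

Lemma integral_mass4 (K nu t : R) : 0 <= K -> 0 <= nu <= (beta - 1) / 2 -> 0 <= t ->
  (\int[mu]_(s in `[0%R, t]) (limn (fun k => (K * mass4 nu 0 k s)%:E)) =
   limn (fun k => (K * prim (mass4 nu 0 k) t)%:E))%E.
Proof.
move=> K0 nub t0.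
have mt : measurable (`[0, t]%classic : set R) by exact: measurable_itv.
have cK k : continuous (fun s => K * mass4 nu 0 k s).
  by move=> s; apply: cvgM; [exact: cvg_cst|exact: continuous_mass4].
have := @cvg_monotone_convergence _ _ _ mu _ mt (fun k s => (K * mass4 nu 0 k s)%:E).
move=> /(_ _ _ _)/cvg_lim <- //.
- congr (limn _); apply/funext => k; rewrite prim_ge//.
  have ik : mu.-integrable `[0, t] (EFin \o mass4 nu 0 k).
    by apply: continuous_itv_integrable; exact: continuous_mass4.
  rewrite -(@RintegralZl _ _ _ mu _ _ K mt ik) /Rintegral fineK//.
  apply: (@integrable_fin_num _ _ _ mu _ mt (EFin \o (fun s => K * mass4 nu 0 k s))).
  exact: continuous_itv_integrable.
- by move=> k; apply/measurable_EFinP; apply: measurable_funTS; exact: continuous_measurable_fun.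
- by move=> k s; rewrite /= in_itv /= => /andP[s0 _]; rewrite lee_fin mulr_ge0// mass4_ge0.
- move=> s; rewrite /= in_itv /= => /andP[s0 _] k m km.
  by rewrite lee_fin ler_wpM2l//; exact: nd_mass4.
Qed.

Lemma nd_prim_mass4 nu c (t : R) : 0 <= t -> nondecreasing_seq (fun k => prim (mass4 nu c k) t).
Proof.
move=> t0 k m km.
have c4 j : continuous (mass4 nu c j) by exact: continuous_mass4.
apply: (le_derive t0 (fun s => is_derive_prim s (c4 k))
  (fun s => is_derive_prim s (c4 m))); first by rewrite !prim0.
by move=> s s0; exact: nd_mass4.
Qed.

(** Giving all of [gamma] to the energy term bounds the integrals of [mass4] by [z0 / gamma] at
    every level, and monotone convergence carries this to the limit. It controls the solution near
    time zero. *)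
Lemma integrable_gmaj (t : R) : 0 <= t -> mu.-integrable `[0, t] (EFin \o gmaj).
Proof.
move=> t0; have [b1 b2] := zero_bounds.
apply/integrableP; split.
  by apply/measurable_EFinP; apply: measurable_funTS; exact: measurable_gmaj.
have nd s : 0 <= s -> nondecreasing_seq (fun k => (mass4 0 0 k s)%:E).
  by move=> s0 k m km; rewrite lee_fin; exact: nd_mass4.
apply: (@le_lt_trans _ _ (\int[mu]_(s in `[0%R, t]) (limn (fun k => (mass4 0 0 k s)%:E)))%E).
  apply: ge0_le_integral => //.
  - by apply/measurable_EFinP; apply: measurableT_comp => //;
      apply: measurable_funTS; exact: measurable_gmaj.
  - apply: (emeasurable_fun_cvg (fun k s => (mass4 0 0 k s)%:E)).
      move=> k; apply/measurable_EFinP; apply: measurable_funTS.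
      by apply: continuous_measurable_fun; exact: continuous_mass4.
    move=> s; rewrite /= in_itv /= => /andP[s0 _].
    exact/cvgP/ereal_nondecreasing_cvgn/nd.
  - move=> s; rewrite /= in_itv /= => /andP[s0 _].
    rewrite /= ger0_norm ?gmaj_ge0//.
    have [s1|s1] := ltP 0 s.
      have := @gmaj_cvg s; rewrite s1; under eq_fun do rewrite mulr1.
      by move=> h; rewrite (cvg_lim _ (cvg_EFin _ h))//; exact: nearW.
    rewrite {1}/gmaj ltNge s1 /=; under eq_fun do rewrite mulr0.
    rewrite lim_cst//; apply: lime_ge; first exact/cvgP/ereal_nondecreasing_cvgn/nd.
    by apply: nearW => k; rewrite lee_fin mass4_ge0.
have -> : (\int[mu]_(s in `[0%R, t]) (limn (fun k => (mass4 0 0 k s)%:E)))%E =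
    limn (fun k => (1 * prim (mass4 0 0 k) t)%:E).
  rewrite -integral_mass4//; apply: eq_integral => s _.
  by congr (limn _); apply/funext => k; rewrite mul1r.
apply: (@le_lt_trans _ _ (z0 / gamma)%:E); last exact: ltry.
apply: lime_le.
  apply/cvgP/ereal_nondecreasing_cvgn => k m km; rewrite lee_fin !mul1r.
  exact: nd_prim_mass4.
apply: nearW => k; rewrite lee_fin mul1r ler_pdivlMr ?gamma_gt0// mulrC.
have := @admissible_mass_bound 0 0 gamma k t b1 (lexx _) (ltW gamma_gt0).
rewrite addr0 => /(_ (lexx _) t0); apply: le_trans; rewrite lerDr.
by apply: sumr_ge0 => u _; rewrite mulr_ge0 ?expR_ge0 ?amp_ge0.
Qed.

(** Dominated convergence twice: in [x] at fixed [s > 0], with the constant [h s], then in [s], with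
    [2 * pi * h s]. The endpoint [s = 0], where nothing is assumed, is removed and restored as a
    null set. *)
Lemma iterated_dominated_cvg (F_ : nat -> R -> R -> R) (F : R -> R -> R) (h : R -> R) (t : R) :
  0 <= t -> (forall k, continuous (fun p : R * R => F_ k p.1 p.2)) ->
  (forall s x, 0 < s <= t -> (fun k => F_ k s x) @ \oo --> F s x) ->
  (forall s, measurable_fun torus (F s)) ->
  mu.-integrable `[0, t] (EFin \o h) ->
  (forall k s x, 0 < s <= t -> x \in torus -> `|F_ k s x| <= h s) ->
  (fun k => \int[mu]_(s in `[0%R, t]) intT (F_ k s)) @ \oo -->
    \int[mu]_(s in `[0%R, t]) intT (F s).
Proof.
move=> t0 cF FF mF ih Fh.
have sub : (`]0, t]%classic : set R) `<=` `[0, t]%classic by exact: subset_itv_oc_cc.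
have m1 : measurable (`]0, t]%classic : set R) by exact: measurable_itv.
have m2 : measurable (`[0, t]%classic : set R) by exact: measurable_itv.
have ih' : mu.-integrable `]0, t] (EFin \o h).
  exact: (@integrableS _ _ _ mu _ _ (EFin \o h) m2 m1 sub ih).
have inner s : 0 < s <= t -> (fun k => intT (F_ k s)) @ \oo --> intT (F s).
  move=> st; apply: (@Rintegral_dominated_cvg R torus (-1) _ _ (cst (h s)) _ _ _ _ _ _).2.
  - exact: measurable_torus.
  - move=> k; apply: measurable_funTS; apply: continuous_measurable_fun.
    exact: (@continuous_section2 R (F_ k) s (cF k)).
  - exact: mF.
  - by move=> x _ _; exact: FF.
  - exact: torus_cst_integrable.
  - by move=> k x xT _; apply: Fh => //; exact/mem_set.
have cI k : continuous (fun s => intT (F_ k s)) by exact: continuous_intT.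
have mI k D : measurable D -> measurable_fun D (fun s => intT (F_ k s)).
  by move=> mD; apply: measurable_funTS; exact: continuous_measurable_fun.
have mIF : measurable_fun `]0, t] (fun s => intT (F s)).
  apply: (@measurable_fun_cvg _ _ _ _ (fun k s => intT (F_ k s))) => [k|s].
    exact: mI.
  by rewrite /= in_itv /=; exact: inner.
have ih2 : mu.-integrable `]0, t] (EFin \o (fun s => 2 * pi * h s)).
  by have := @integrableZl _ _ _ mu _ m1 (2 * pi) _ ih'; apply.
have [iF] := @Rintegral_dominated_cvg R `]0, t] (-1) (fun k s => intT (F_ k s))
  (fun s => intT (F s)) (fun s => 2 * pi * h s) m1 (fun k => mI k _ m1) mIF
  (fun s st _ => inner s ltac:(by move: st; rewrite /= in_itv)) ih2
  (fun k s st _ => ltac:(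
    have st' : 0 < s <= t by [move: st; rewrite /= in_itv];
    have cs := @continuous_section2 R (F_ k) s (cF k);
    apply: (le_trans (intT_norm (continuous_L1T cs)));
    rewrite mulrC -intT_cst; apply: intT_le;
      [have := integrable_norm (continuous_L1T cs); apply | exact: torus_cst_integrable |
       by move=> x xT; exact: Fh])).
rewrite (Rintegral_itv_obnd_cbnd iF).
suff -> : (fun k => \int[mu]_(s in `]0%R, t]) intT (F_ k s)) =
    (fun k => \int[mu]_(s in `[0%R, t]) intT (F_ k s)) by [].
apply/funext => k; apply: Rintegral_itv_obnd_cbnd.
exact: (@integrableS _ _ _ mu _ _ _ m2 m1 sub (continuous_itv_integrable 0 t (cI k))).
Qed.

Lemma zeta_norm_le i k (t x : R) : (i <= 4)%N -> 0 < t -> `|zeta_ i k t x| <= gmaj t.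
Proof.
move=> i4 t0; apply: (le_trans (ler_norm_sum _ _ _)).
by apply: le_trans (mass4_le_gmaj k t0); apply: zeta_le => //; exact: ltW.
Qed.

Lemma zeta0_norm_le k (t x : R) : 0 <= t -> `|zeta_ 0 k t x| <= z0.
Proof. by move=> t0; apply: (le_trans (ler_norm_sum _ _ _)); exact: zeta0_le. Qed.

Lemma zeta_cvg i t x : (i <= 4)%N -> 0 < t ->
  (fun k => zeta_ i k t x) @ \oo --> zlim i t x.
Proof.
move=> i4 t0; have := @zcut_cvg i t x i4.
by under eq_fun do rewrite zcut_gt0//.
Qed.

Lemma zeta0_cvg t x : 0 <= t -> (fun k => zeta_ 0 k t x) @ \oo --> zlim 0 t x.
Proof.
move=> t0; have := @zcut_cvg 0 t x isT.
by under eq_fun do rewrite zcut_ge0//.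
Qed.

Lemma zlim_norm_le i (t x : R) : (i <= 4)%N -> 0 < t -> `|zlim i t x| <= gmaj t.
Proof.
move=> i4 t0; have h := cvg_norm (zeta_cvg (x := x) i4 t0).
apply: (cvgr_to_le (h _)).
by apply: nearW => k; exact: zeta_norm_le.
Qed.

Lemma zlim0_norm_le (t x : R) : 0 <= t -> `|zlim 0 t x| <= z0.
Proof.
move=> t0; have h := cvg_norm (zeta0_cvg (x := x) t0).
apply: (cvgr_to_le (h _)).
by apply: nearW => k; exact: zeta0_norm_le.
Qed.

Lemma zlim0_clip (t x : R) : t <= 0 -> zlim 0 t x = zlim 0 0 x.
Proof. by move=> t0; rewrite /zlim /zcut !max_r. Qed.

Lemma zlim0_norm_leT (t x : R) : `|zlim 0 t x| <= z0.
Proof.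
have [t0|/ltW t0] := leP 0 t; first exact: zlim0_norm_le.
by rewrite zlim0_clip// zlim0_norm_le.
Qed.

Lemma intT_zeta0_cvg (psi : R -> R) t : 0 <= t -> continuous psi ->
  (fun k => intT (fun x => zeta_ 0 k t x * psi x)) @ \oo -->
  intT (fun x => zlim 0 t x * psi x).
Proof.
move=> t0 cpsi.
have cz k : continuous (zeta_ 0 k t).
  exact: (@continuous_section2 R (zeta_ 0 k) t (@continuous_zeta R eps beta rho theta 0 k)).
have mpsi : measurable_fun torus psi.
  by apply: measurable_funTS; exact: continuous_measurable_fun.
apply: (@Rintegral_dominated_cvg R torus (-1) _ _ (fun x => z0 * `|psi x|) _ _ _ _ _ _).2.
- exact: measurable_torus.
- move=> k; apply: measurable_funM => //.
  by apply: measurable_funTS; exact: continuous_measurable_fun.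
- apply: measurable_funM => //.
  by apply: measurable_section; [exact: jmeas_zlim|exact: measurable_torus].
- by move=> x _ _; apply: cvgM; [exact: zeta0_cvg|exact: cvg_cst].
- apply: (L1TZ z0); have := integrable_norm (continuous_L1T cpsi); apply.
- by move=> k x _ _; rewrite normrM ler_wpM2r// zeta0_norm_le.
Qed.

Lemma intT_zeta_cvg i (psi : R -> R) t : (i <= 4)%N -> 0 < t -> continuous psi ->
  (fun k => intT (fun x => zeta_ i k t x * psi x)) @ \oo -->
  intT (fun x => zlim i t x * psi x).
Proof.
move=> i4 t0 cpsi.
have cz k : continuous (zeta_ i k t).
  exact: (@continuous_section2 R (zeta_ i k) t (@continuous_zeta R eps beta rho theta i k)).
have mpsi : measurable_fun torus psi.
  by apply: measurable_funTS; exact: continuous_measurable_fun.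
apply: (@Rintegral_dominated_cvg R torus (-1) _ _ (fun x => gmaj t * `|psi x|) _ _ _ _ _ _).2.
- exact: measurable_torus.
- move=> k; apply: measurable_funM => //.
  by apply: measurable_funTS; exact: continuous_measurable_fun.
- apply: measurable_funM => //.
  by apply: measurable_section; [exact: jmeas_zlim|exact: measurable_torus].
- by move=> x _ _; apply: cvgM; [exact: zeta_cvg|exact: cvg_cst].
- apply: (L1TZ (gmaj t)); have := integrable_norm (continuous_L1T cpsi); apply.
- by move=> k x _ _; rewrite normrM ler_wpM2r// zeta_norm_le.
Qed.

(** Integration by parts is exact at each level, and both sides converge. *)
Lemma weak_derivative i (psi dpsi : R -> R) t : (i < 4)%N -> 0 < t ->
  (forall x : R, is_derive x 1 psi (dpsi x)) -> continuous dpsi ->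
  (forall x, psi (x + 2 * pi) = psi x) ->
  intT (fun x => zlim i t x * dpsi x) = - intT (fun x => zlim i.+1 t x * psi x).
Proof.
move=> i4 t0 dp cdp per.
have cpsi := is_derive_continuous dp.
have h1 := intT_zeta_cvg (ltnW i4) t0 cdp.
have h2 := cvgN (intT_zeta_cvg i4 t0 cpsi).
have e : (fun k => intT (fun x => zeta_ i k t x * dpsi x)) =
    (fun k => - intT (fun x => zeta_ i.+1 k t x * psi x)).
  apply/funext => k.
  apply: (intT_by_parts (fun x => is_derive_zeta_x eps beta rho theta k t x i4) dp _ cdp).
    exact: (@continuous_section2 R (zeta_ i.+1 k) t (@continuous_zeta R eps beta rho theta i.+1 k)).
  by rewrite -[2 * pi]add0r zeta_periodic per.
by move: h1; rewrite e => h1; exact: (cvg_unique (@Rhausdorff R) h1 (h2 _)).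
Qed.

(** * Limit of the weak formulation *)

Section weak_limit.
Variables (phi phit phix : R -> R -> R).
Hypothesis cphi : continuous (fun p : R * R => phi p.1 p.2).
Hypothesis cphit : continuous (fun p : R * R => phit p.1 p.2).
Hypothesis cphix : continuous (fun p : R * R => phix p.1 p.2).
Hypothesis dphit : forall t x : R, is_derive t 1 (phi ^~ x) (phit t x).
Hypothesis dphix : forall t x : R, is_derive x 1 (phi t) (phix t x).
Hypothesis phi_periodic : forall t x, phi t (x + 2 * pi) = phi t x.

Lemma flux_cvg i t x : (i <= 4)%N -> 0 < t ->
  (fun k => flux i k t x) @ \oo --> (1 + eps * zlim 0 t x) * zlim i t x.
Proof.
move=> i4 t0; rewrite mulrDl mul1r; apply: cvgD.
  by have := zeta_cvg (x := x) i4 t0; rewrite -cvg_shiftS.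
apply: cvgM; last exact: zeta_cvg.
by apply: cvgM; [exact: cvg_cst|exact: zeta_cvg].
Qed.

Lemma int_flux_cvg i t : (i <= 4)%N -> 0 <= t ->
  (fun k => \int[mu]_(s in `[0%R, t]) intT (fun x => flux i k s x * phix s x)) @ \oo -->
  \int[mu]_(s in `[0%R, t])
    intT (fun x => (1 + eps * zlim 0 s x) * zlim i s x * phix s x).
Proof.
move=> i4 t0.
have [M [M0 hM]] := continuous_bounded_rectangle 0 t 0 (2 * pi) cphix.
have mt : measurable (`[0, t]%classic : set R) by exact: measurable_itv.
(* In the product the undifferentiated factor is bounded by [z0] and only the other one by [gmaj],
   so the majorant is linear in [gmaj] and remains integrable. *)
apply: (@iterated_dominated_cvg (fun k s x => flux i k s x * phix s x) _
  (fun s => ((1 + eps * z0) * M) * gmaj s)) => //.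
- by move=> k; exact: (continuous_mul2 (@continuous_flux R eps beta rho theta i k) cphix).
- by move=> s x /andP[s0 _]; apply: cvgM; [exact: flux_cvg|exact: cvg_cst].
- move=> s; have mT := @measurable_torus R.
  apply: measurable_funM; last first.
    apply: measurable_funTS; apply: continuous_measurable_fun.
    exact: (@continuous_section2 R phix s cphix).
  apply: measurable_funM; last by apply: measurable_section => //; exact: jmeas_zlim.
  apply: measurable_funD => //; apply: measurable_funM => //.
  by apply: measurable_section => //; exact: jmeas_zlim.
- by have := @integrableZl _ _ _ mu _ mt ((1 + eps * z0) * M) _ (integrable_gmaj t0); apply.
- move=> k s x /andP[s0 st] xT.
  rewrite normrM mulrAC; apply: ler_pM => //; last first.
    by apply: hM; [rewrite in_itv /= (ltW s0)|exact/set_mem].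
  rewrite mulrDl mul1r; apply: (le_trans (ler_normD _ _)); apply: lerD.
    exact: zeta_norm_le.
  rewrite normrM; apply: ler_pM => //; last exact: zeta_norm_le.
  by rewrite normrM gtr0_norm// ler_wpM2l ?(ltW eps0)// zeta0_norm_le// ltW.
Qed.

Lemma int_zeta_cvg t : 0 <= t ->
  (fun k => \int[mu]_(s in `[0%R, t]) intT (fun x => zeta_ 0 k.+1 s x * phit s x)) @ \oo -->
  \int[mu]_(s in `[0%R, t]) intT (fun x => zlim 0 s x * phit s x).
Proof.
move=> t0.
have [M [M0 hM]] := continuous_bounded_rectangle 0 t 0 (2 * pi) cphit.
apply: (@iterated_dominated_cvg (fun k s x => zeta_ 0 k.+1 s x * phit s x) _
  (cst (z0 * M))) => //.
- by move=> k; exact: (continuous_mul2 (@continuous_zeta R eps beta rho theta 0 k.+1) cphit).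
- move=> s x /andP[s0 _]; apply: cvgM; last exact: cvg_cst.
  by have := zeta0_cvg (x := x) (ltW s0); rewrite -cvg_shiftS.
- move=> s; have mT := @measurable_torus R.
  apply: measurable_funM; last first.
    apply: measurable_funTS; apply: continuous_measurable_fun.
    exact: (@continuous_section2 R phit s cphit).
  by apply: measurable_section => //; exact: jmeas_zlim.
- by apply: continuous_itv_integrable => x; exact: cvg_cst.
- move=> k s x /andP[s0 st] xT; rewrite normrM; apply: ler_pM => //.
    by apply: zeta0_norm_le; exact: ltW.
  by apply: hM; [rewrite in_itv /= (ltW s0)|exact/set_mem].
Qed.

Lemma weak_limit t : 0 <= t ->
  intT (fun x => zlim 0 t x * phi t x) - intT (fun x => zlim 0 0 x * phi 0 x)
  - \int[mu]_(s in `[0%R, t]) intT (fun x => zlim 0 s x * phit s x) =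
  \int[mu]_(s in `[0%R, t])
    intT (fun x => (1 + eps * zlim 0 s x) * zlim 1 s x * phix s x) +
  beta * \int[mu]_(s in `[0%R, t])
    intT (fun x => (1 + eps * zlim 0 s x) * zlim 3 s x * phix s x).
Proof.
move=> t0.
have cp s := @continuous_section2 R phi s cphi.
have z1 s : 0 <= s -> (fun k => intT (fun x => zeta_ 0 k.+1 s x * phi s x)) @ \oo -->
    intT (fun x => zlim 0 s x * phi s x).
  by move=> s0; have := intT_zeta0_cvg s0 (cp s); rewrite -cvg_shiftS.
have L : (fun k => intT (fun x => zeta_ 0 k.+1 t x * phi t x) -
    intT (fun x => zeta_ 0 k.+1 0 x * phi 0 x) -
    \int[mu]_(s in `[0%R, t]) intT (fun x => zeta_ 0 k.+1 s x * phit s x)) @ \oo -->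
  intT (fun x => zlim 0 t x * phi t x) - intT (fun x => zlim 0 0 x * phi 0 x)
  - \int[mu]_(s in `[0%R, t]) intT (fun x => zlim 0 s x * phit s x).
  by apply: cvgB; [apply: cvgB; exact: z1|exact: int_zeta_cvg].
have Rr : (fun k => \int[mu]_(s in `[0%R, t]) intT (fun x => flux 1 k s x * phix s x) +
    beta * \int[mu]_(s in `[0%R, t]) intT (fun x => flux 3 k s x * phix s x)) @ \oo -->
  \int[mu]_(s in `[0%R, t])
    intT (fun x => (1 + eps * zlim 0 s x) * zlim 1 s x * phix s x) +
  beta * \int[mu]_(s in `[0%R, t])
    intT (fun x => (1 + eps * zlim 0 s x) * zlim 3 s x * phix s x).
  apply: cvgD; first exact: int_flux_cvg.
  by apply: cvgM; [exact: cvg_cst|exact: int_flux_cvg].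
move: L; under eq_fun => k do rewrite
  (weak_level eps beta rho theta cphi cphit cphix dphit dphix phi_periodic k t0).
by move=> L; exact: (cvg_unique (@Rhausdorff R) L Rr).
Qed.

End weak_limit.

Lemma fourier_re_zlim_cvg t (p : int) : 0 <= t ->
  (fun k => fourier_re (zeta_ 0 k t) p) @ \oo --> fourier_re (zlim 0 t) p.
Proof.
move=> t0; apply: cvgM; first exact: cvg_cst.
by apply: intT_zeta0_cvg => //; exact: continuous_cosf.
Qed.

Lemma fourier_im_zlim_cvg t (p : int) : 0 <= t ->
  (fun k => fourier_im (zeta_ 0 k t) p) @ \oo --> fourier_im (zlim 0 t) p.
Proof.
move=> t0; apply: cvgN; apply: cvgM; first exact: cvg_cst.
by apply: intT_zeta0_cvg => //; exact: continuous_sinf.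
Qed.

Lemma fourier_abs_zlim_cvg t (p : int) : 0 <= t ->
  (fun k => fourier_abs (zeta_ 0 k t) p) @ \oo --> fourier_abs (zlim 0 t) p.
Proof.
move=> t0; have cr := @fourier_re_zlim_cvg t p t0; have ci := @fourier_im_zlim_cvg t p t0.
have cs : (fun k => fourier_re (zeta_ 0 k t) p ^+ 2 + fourier_im (zeta_ 0 k t) p ^+ 2) @ \oo -->
    fourier_re (zlim 0 t) p ^+ 2 + fourier_im (zlim 0 t) p ^+ 2.
  by apply: cvgD; rewrite expr2; under eq_fun do rewrite expr2; apply: cvgM.
exact: (continuous_cvg _ (@sqrt_continuous R _) cs).
Qed.

Lemma samp_le_amp u t : 0 <= t -> `|samp u t| <= amp u t.
Proof.
move=> t0; rewrite normrM (ger0_norm (amp_ge0 _ _ _ _ _))// -[leRHS]mul1r.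
by rewrite ler_wpM2r ?amp_ge0// sgn_le1.
Qed.

(** Fatou's argument: the Wiener norm is a supremum over finite sets of frequencies, and on each of
    them the coefficients converge. *)
Lemma wnorm_zlim_le (s lam t : R) : 0 <= t ->
  (wnorm s lam (zlim 0 t) <= limn (fun k => (\sum_(u <- level k)
     (1 + `|fr u|) `^ s * expR (lam * `|fr u|) * amp u t)%:E))%E.
Proof.
move=> t0.
pose w (p : int) : R := (1 + `|p%:~R|) `^ s * expR (lam * `|p%:~R|).
have w0 p : 0 <= w p by rewrite mulr_ge0 ?powR_ge0 ?expR_ge0.
have wN p : w (- p) = w p by rewrite /w intrN normrN.
have nd : nondecreasing_seq (fun k => (\sum_(u <- level k)
    (1 + `|fr u|) `^ s * expR (lam * `|fr u|) * amp u t)%:E).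
  move=> k m km; rewrite lee_fin; apply: nd_sum_level => // u.
  by rewrite mulr_ge0 ?amp_ge0//; exact: (w0 (freq u)).
apply: ge_ereal_sup => _ [A [Afin _] <-].
rewrite fsbig_finite//=.
move: (finmap.enum_fset _) (finmap.fset_uniq (fset_set A)) => r ur.
rewrite sumEFin.
pose S k := \sum_(p <- r) w p * fourier_abs (zeta_ 0 k t) p.
have cS : S @ \oo --> \sum_(p <- r) w p * fourier_abs (zlim 0 t) p.
  rewrite /S; elim: (r) => [|p q ih].
    by under eq_fun do rewrite big_nil; rewrite big_nil; exact: cvg_cst.
  under eq_fun do rewrite big_cons; rewrite big_cons; apply: cvgD => //.
  by apply: cvgM; [exact: cvg_cst|exact: fourier_abs_zlim_cvg].
have cSE : (fun k => (S k)%:E) @ \oo -->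
    (\sum_(p <- r) w p * fourier_abs (zlim 0 t) p)%:E.
  by apply: cvg_EFin => //; exact: nearW.
rewrite -(cvg_lim _ cSE)//; apply: lee_lim.
- exact/cvgP/cSE.
- exact/cvgP/ereal_nondecreasing_cvgn.
apply: nearW => k; rewrite lee_fin.
apply: (le_trans (@weighted_fourier_abs_wave_sum R theta (samp ^~ t) k w _ ur w0 wN)).
by apply: ler_sum => u _; rewrite ler_wpM2l// samp_le_amp.
Qed.

Lemma wnorm_ge0 (s lam : R) (f : R -> R) : (0 <= wnorm s lam f)%E.
Proof.
apply: esum_ge0 => p _.
by rewrite lee_fin !mulr_ge0 ?powR_ge0 ?expR_ge0 ?fourier_abs_ge0.
Qed.

Lemma wnorm0_zlim_le (nu t : R) : 0 <= t ->
  (wnorm 0 (nu * t) (zlim 0 t) <= limn (fun k => (mass nu 0 k t)%:E))%E.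
Proof.
move=> t0; apply: (le_trans (wnorm_zlim_le _ _ t0)).
have -> // : (fun k => (\sum_(u <- level k)
    (1 + `|fr u|) `^ 0 * expR (nu * t * `|fr u|) * amp u t)%:E) = (fun k => (mass nu 0 k t)%:E).
apply/funext => k; congr (_%:E); apply: eq_bigr => u _.
by rewrite powRr0 mul1r /weight add0r mulrAC.
Qed.

(** The 16 pays for replacing the inhomogeneous weight: [1 + n <= 2 n] for [n >= 1], raised to the
    fourth power. *)
Lemma wnorm4_zlim_le (nu t : R) : 0 <= t ->
  (wnorm 4 (nu * t) (zlim 0 t) <= limn (fun k => (16 * mass4 nu 0 k t)%:E))%E.
Proof.
move=> t0; apply: (le_trans (wnorm_zlim_le _ _ t0)); apply: lee_lim.
- apply/cvgP/ereal_nondecreasing_cvgn => k m km; rewrite lee_fin; apply: nd_sum_level => // u.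
  by rewrite !mulr_ge0 ?powR_ge0 ?expR_ge0 ?amp_ge0.
- apply/cvgP/ereal_nondecreasing_cvgn => k m km; rewrite lee_fin ler_wpM2l//.
  exact: nd_mass4.
apply: nearW => k; rewrite lee_fin /mass4 mulr_sumr; apply: ler_sum => u _.
have [u0|u0] := eqVneq (freq u) 0; first by rewrite amp_freq0// !mulr0.
have h := @fr_neq0 R _ u0.
have -> : expR (nu * t * `|fr u|) = weight nu 0 u t by rewrite /weight add0r mulrAC.
rewrite mulrA -mulrA ler_wpM2r ?mulr_ge0 ?expR_ge0 ?amp_ge0//.
rewrite (@powR_mulrn R _ 4) ?addr_ge0//.
rewrite (_ : 16 * `|fr u| ^+ 4 = (2 * `|fr u|) ^+ 4); last by ring.
by rewrite lerXn2r ?nnegrE ?addr_ge0 ?mulr_ge0//; lra.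
Qed.

Lemma integral_wnorm4_le (nu t : R) : 0 <= nu <= (beta - 1) / 2 -> 0 <= t ->
  (\int[mu]_(s in `[0%R, t]) wnorm 4 (nu * s) (zlim 0 s) <=
   limn (fun k => (16 * prim (mass4 nu 0 k) t)%:E))%E.
Proof.
move=> nub t0; rewrite -integral_mass4//; apply: ge0_le_integral_nonmeasurable.
  by move=> s _; exact: wnorm_ge0.
by move=> s; rewrite /= in_itv /= => /andP[s0 _]; exact: wnorm4_zlim_le.
Qed.

Lemma cvg_mass nu c t : 0 <= nu <= (beta - 1) / 2 -> 0 <= c <= gamma -> 0 <= t ->
  cvgn (mass nu c ^~ t).
Proof.
move=> nub cb t0; apply: (@cvg_nd_bounded _ _ z0); first exact: nd_mass.
by move=> k; exact: mass_le.
Qed.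

Lemma prim_mass4_le nu k t : 0 <= nu <= (beta - 1) / 2 -> 0 <= t ->
  mass nu 0 k t + gamma * prim (mass4 nu 0 k) t <= z0.
Proof.
by move=> nub t0; apply: admissible_mass_bound; rewrite ?addr0//; exact/ltW/gamma_gt0.
Qed.

Lemma mass_ge0 nu c k t : 0 <= t -> 0 <= mass nu c k t.
Proof. by move=> t0; apply: sumr_ge0 => u _; rewrite mulr_ge0 ?expR_ge0 ?amp_ge0. Qed.

Lemma cvg_prim_mass4 nu t : 0 <= nu <= (beta - 1) / 2 -> 0 <= t ->
  cvgn (fun k => prim (mass4 nu 0 k) t).
Proof.
move=> nub t0; apply: (@cvg_nd_bounded _ _ (z0 / gamma)); first exact: nd_prim_mass4.
move=> k; rewrite ler_pdivlMr ?gamma_gt0// mulrC.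
by apply: le_trans (prim_mass4_le k nub t0); rewrite lerDr mass_ge0.
Qed.

Lemma EFin_limn (u : nat -> R) (l : R) : u @ \oo --> l -> limn (fun k => (u k)%:E) = l%:E.
Proof. by move=> ul; apply: cvg_lim => //; apply: cvg_EFin => //; exact: nearW. Qed.

Lemma energy (nu t : R) : 0 <= nu <= (beta - 1) / 2 -> 0 <= t ->
  (wnorm 0 (nu * t) (zlim 0 t) + ((beta - 1) / 64)%:E *
     \int[mu]_(s in `[0%R, t]) wnorm 4 (nu * s) (zlim 0 s) <= z0%:E)%E /\
  (\int[mu]_(s in `[0%R, t]) wnorm 4 (nu * s) (zlim 0 s) < +oo)%E.
Proof.
move=> nub t0; have [_ b2] := zero_bounds.
have /cvg_ex[m cm] := cvg_mass nub b2 t0.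
have /cvg_ex[y cy] := cvg_prim_mass4 nub t0.
have c16 : (fun k => 16 * prim (mass4 nu 0 k) t) @ \oo --> 16 * y.
  by apply: cvgM => //; exact: cvg_cst.
have I16 := integral_wnorm4_le nub t0; rewrite (EFin_limn c16) in I16.
have W0 := wnorm0_zlim_le nu t0; rewrite (EFin_limn cm) in W0.
split; last by apply: (le_lt_trans I16); exact: ltry.
apply: (@le_trans _ _ (m%:E + ((beta - 1) / 64)%:E * (16 * y)%:E)%E).
  apply: leeD => //; apply: lee_wpmul2l => //.
  by rewrite lee_fin divr_ge0// subr_ge0 ltW.
rewrite -EFinM -EFinD lee_fin.
have -> : (beta - 1) / 64 * (16 * y) = gamma * y by rewrite /gamma; field.
have cs : (fun k => mass nu 0 k t + gamma * prim (mass4 nu 0 k) t) @ \oo --> m + gamma * y.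
  by apply: cvgD => //; apply: cvgM => //; exact: cvg_cst.
by apply: (cvgr_to_le cs); apply: nearW => k; exact: prim_mass4_le.
Qed.

(** The decay weight does not depend on the tree, so it factors out of [mass nu c], which [mass_le]
    keeps below [z0] for the rate [c = (beta - 1) / 64 <= gamma]. *)
Lemma decay (nu t : R) : 0 <= nu <= (beta - 1) / 2 -> 0 <= t ->
  (wnorm 0 (nu * t) (zlim 0 t) <= z0%:E * (expR (- (t / 64) * (beta - 1)))%:E)%E.
Proof.
move=> nub t0; apply: (le_trans (wnorm0_zlim_le nu t0)).
pose c := (beta - 1) / 64.
have cb : 0 <= c <= gamma by have := beta1; rewrite /c /gamma => ?; apply/andP; split; lra.
apply: lime_le.
  apply/cvgP/ereal_nondecreasing_cvgn => k m km; rewrite lee_fin; exact: nd_mass.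
apply: nearW => k; rewrite lee_fin.
have e : mass nu c k t = expR (c * t) * mass nu 0 k t.
  rewrite /mass mulr_sumr; apply: eq_bigr => u _.
  by rewrite /weight add0r mulrDl expRD mulrA.
have := mass_le k nub cb t0; rewrite e mulrC -ler_pdivlMr ?expR_gt0// -expRN.
by rewrite (_ : - (c * t) = - (t / 64) * (beta - 1)); last by rewrite /c; field.
Qed.

Lemma sum_samp0 k (f : tree -> R) :
  \sum_(u <- level k.+1) samp u 0 * f u = \sum_(j <- iota 0 k.+1) rho j * f (Leaf j).
Proof.
under eq_bigr do rewrite /samp mulrAC.
by rewrite sum_amp0; apply: eq_bigr => j _; rewrite /= mul1r mulrC.
Qed.

Lemma sum_iota_delta k (q : nat) (f : nat -> R) : (q < k)%N ->
  \sum_(j <- iota 0 k) f j * (j%:Z == q%:Z)%:R = f q.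
Proof.
move=> qk; rewrite (bigD1_seq q) ?iota_uniq ?mem_iota//= eqxx mulr1 big1 ?addr0// => j jq.
by rewrite eqz_nat (negbTE jq) mulr0.
Qed.

Lemma sum_iota_deltaN k (q : nat) (f : nat -> R) :
  \sum_(j <- iota 0 k) rho j * f j * (j%:Z == - q%:Z)%:R = 0.
Proof.
rewrite big1// => j _; case: eqP => [|_]; last by rewrite mulr0.
(* [j = - q] between naturals forces [j = q = 0], where the amplitude vanishes. *)
by case: j => [|j]; [rewrite rho0 !mul0r|case: q].
Qed.

Lemma fourier_re_zlim0 (q : nat) : fourier_re (zlim 0 0) q = rho q * (2^-1 * cos (theta q)).
Proof.
apply: (cvg_unique (@Rhausdorff R) (@fourier_re_zlim_cvg 0 q (lexx _))).
(* At time zero only leaves contribute, so the coefficient is stationary once [Leaf q] has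
   entered. *)
apply: cvg_near_cst; exists q.+1 => // k /= qk.
move: k qk => [//|k] qk.
rewrite (fourier_re_wave_sum theta (samp ^~ 0)) sum_samp0.
transitivity (\sum_(j <- iota 0 k.+1) rho j * (2^-1 * cos (theta j)) * (j%:Z == q%:Z)%:R +
    \sum_(j <- iota 0 k.+1) rho j * (2^-1 * cos (theta j)) * (j%:Z == - q%:Z)%:R).
  by rewrite -big_split; apply: eq_bigr => j _; rewrite fourier_re_wave /=; ring.
by rewrite (sum_iota_delta (fun j => rho j * (2^-1 * cos (theta j)))) // sum_iota_deltaN addr0.
Qed.

Lemma fourier_im_zlim0 (q : nat) : fourier_im (zlim 0 0) q = rho q * (2^-1 * sin (theta q)).
Proof.
apply: (cvg_unique (@Rhausdorff R) (@fourier_im_zlim_cvg 0 q (lexx _))).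
apply: cvg_near_cst; exists q.+1 => // k /= qk.
move: k qk => [//|k] qk.
rewrite (fourier_im_wave_sum theta (samp ^~ 0)) sum_samp0.
transitivity (\sum_(j <- iota 0 k.+1) rho j * (2^-1 * sin (theta j)) * (j%:Z == q%:Z)%:R -
    \sum_(j <- iota 0 k.+1) rho j * (2^-1 * sin (theta j)) * (j%:Z == - q%:Z)%:R).
  by rewrite -sumrB; apply: eq_bigr => j _; rewrite fourier_im_wave /=; ring.
by rewrite (sum_iota_delta (fun j => rho j * (2^-1 * sin (theta j)))) // sum_iota_deltaN subr0.
Qed.

End limits.

(** * Initial datum *)

Section initial_data.
Context {R : realType}.
Local Notation mu := (@lebesgue_measure R).
Local Notation torus := (@torus R).

Lemma polar (a b : R) : exists th, a = norm2 a b * cos th /\ b = norm2 a b * sin th.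
Proof.
have [n0|n0] := eqVneq (norm2 a b) 0.
  have h : a ^+ 2 + b ^+ 2 = 0 by rewrite -sqr_norm2 n0 expr0n.
  exists 0; rewrite n0 !mul0r.
  have [a0 b0] := (sqr_ge0 a, sqr_ge0 b).
  by split; apply/eqP; rewrite -sqrf_eq0; apply/eqP; lra.
have n_gt0 : 0 < norm2 a b by rewrite lt_def n0 norm2_ge0.
pose c := a / norm2 a b; pose s := b / norm2 a b.
have cs : c ^+ 2 + s ^+ 2 = 1.
  by rewrite /c /s !exprMn -mulrDl -sqr_norm2 exprVn mulfV// expf_neq0.
have c1 : -1 <= c <= 1.
  have := sqr_ge0 s => s0.
  by rewrite -ler_norml -(@ler_sqr _ `|c| 1) ?nnegrE// real_normK ?num_real// expr1n; lra.
have sq : Num.sqrt (1 - c ^+ 2) = `|s| by rewrite -cs addrAC subrr add0r sqrtr_sqr.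
have nc : norm2 a b * c = a by rewrite mulrCA mulfV ?mulr1.
have ns : norm2 a b * s = b by rewrite mulrCA mulfV ?mulr1.
have cA : cos (acos c) = c by apply: acosK; rewrite in_itv.
have sA : sin (acos c) = `|s| by rewrite sin_acos.
(* [acos] fixes the angle up to sign; the sign of [b] decides. *)
have [s0|s0] := leP 0 s.
  by exists (acos c); rewrite cA sA ger0_norm// nc ns.
by exists (- acos c); rewrite cosN sinN cA sA ltr0_norm// opprK nc ns.
Qed.

(** Lets the datum be replaced by the limit at time zero in the weak identity, with no pointwise
    comparison of the two. Nonnegative frequencies suffice because the functions are real. *)
Lemma eq_fourier_intT (f g phi dphi : R -> R) : L1T f -> L1T g ->
  (forall q : nat, fourier_re f q = fourier_re g q /\ fourier_im f q = fourier_im g q) ->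
  (forall t : R, is_derive t 1 phi (dphi t)) -> continuous dphi ->
  (forall t : R, phi (t + 2 * pi) = phi t) ->
  intT (fun x => f x * phi x) = intT (fun x => g x * phi x).
Proof.
move=> fL gL fg dphiE cdphi per.
have gL' : L1T (fun x => -1 * g x) by exact: L1TZ.
have hL := L1TD fL gL'.
have split w : continuous w -> intT (fun x => (f x + -1 * g x) * w x) =
    intT (fun x => f x * w x) - intT (fun x => g x * w x).
  move=> cw; have fw := L1TM fL cw; have gw := L1TM gL cw.
  rewrite -intTN// -intTD//; last by have := L1TM gL' cw; under eq_fun do rewrite mulN1r mulNr.
  by apply: eq_Rintegral => x _; ring.
have pi0 : (2 * pi)^-1 != 0 :> R by rewrite invr_eq0 mulf_neq0// lt0r_neq0// pi_gt0.
have fgc (q : nat) : intT (fun x => f x * cos (q%:~R * x)) = intT (fun x => g x * cos (q%:~R * x)).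
  by have [/(mulfI pi0)] := fg q.
have fgs (q : nat) : intT (fun x => f x * sin (q%:~R * x)) = intT (fun x => g x * sin (q%:~R * x)).
  by have [_ /oppr_inj/(mulfI pi0)] := fg q.
apply/eqP; rewrite -subr_eq0 -split; last exact: is_derive_continuous dphiE.
apply/eqP; apply: (fourier_uniqueness hL _ dphiE cdphi per) => p.
rewrite !split; [|exact: continuous_sinf|exact: continuous_cosf].
suff [-> ->] : intT (fun x => f x * cos (p%:~R * x)) = intT (fun x => g x * cos (p%:~R * x)) /\
    intT (fun x => f x * sin (p%:~R * x)) = intT (fun x => g x * sin (p%:~R * x)).
  by rewrite !subrr.
case: p => q; first by split; [exact: fgc|exact: fgs].
have c (k : R -> R) : (fun x => k x * cos ((Negz q)%:~R * x)) = (fun x => k x * cos (q.+1%:~R * x)).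
  by apply/funext => x; rewrite NegzE intrN mulNr cosN.
have s (k : R -> R) : L1T k -> intT (fun x => k x * sin ((Negz q)%:~R * x)) =
    - intT (fun x => k x * sin (q.+1%:~R * x)).
  move=> kL; rewrite -intTN; last exact/L1TM/continuous_sinf.
  by apply: eq_Rintegral => x _; rewrite NegzE intrN mulNr sinN mulrN.
by rewrite !c !s//; split; [exact: fgc|rewrite fgs].
Qed.

Variable zeta0 : R -> R.
Hypothesis zeta0_L1 : L1T zeta0.
Hypothesis zeta0_mean : intT zeta0 = 0.

Lemma fourier_abs_zero_mean : fourier_abs zeta0 0 = 0.
Proof.
have hr : fourier_re zeta0 0 = 0.
  rewrite /fourier_re -[RHS](mulr0 (2 * pi)^-1) -[X in _ = _ * X]zeta0_mean.
  by congr (_ * _); apply: eq_Rintegral => x _; rewrite mul0r cos0 mulr1.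
have hi : fourier_im zeta0 0 = 0.
  apply/eqP; rewrite oppr_eq0; apply/eqP.
  rewrite -[RHS](mulr0 (2 * pi)^-1) -[X in _ = _ * X](mul0r (2 * pi)) -intT_cst.
  by congr (_ * _); apply: eq_Rintegral => x _; rewrite mul0r sin0 mulr0.
by rewrite /fourier_abs hr hi expr0n addr0 sqrtr0.
Qed.

(** For [j > 0], a cosine of amplitude [r] has coefficients of modulus [r / 2] at [j] and [- j];
    hence the factor 2. *)
Definition leaf_amp (j : nat) : R := 2 * fourier_abs zeta0 j.

Lemma leaf_amp_ge0 j : 0 <= leaf_amp j.
Proof. by rewrite mulr_ge0 ?fourier_abs_ge0. Qed.

Lemma leaf_amp_zero : leaf_amp 0 = 0.
Proof. by rewrite /leaf_amp fourier_abs_zero_mean mulr0. Qed.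

Lemma leaf_amp_phase : exists theta : nat -> R, forall j : nat,
  fourier_re zeta0 j = leaf_amp j * (2^-1 * cos (theta j)) /\
  fourier_im zeta0 j = leaf_amp j * (2^-1 * sin (theta j)).
Proof.
have h (j : nat) : exists th, fourier_re zeta0 j = leaf_amp j * (2^-1 * cos th) /\
    fourier_im zeta0 j = leaf_amp j * (2^-1 * sin th).
  have [th [h1 h2]] := polar (fourier_re zeta0 j) (fourier_im zeta0 j).
  by exists th; rewrite /leaf_amp fourier_absE; split; [rewrite {1}h1|rewrite {1}h2]; field.
by have [theta ht] := choice h; exists theta.
Qed.

Lemma wnorm00E : wnorm 0 0 zeta0 = (\esum_(n in [set: int]) (fourier_abs zeta0 n)%:E)%E.
Proof. by apply: eq_esum => n _; rewrite powRr0 mul0r expR0 !mul1r. Qed.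

(** The factor 2 is shared between the equal moduli at [j] and [- j], so no constant is lost against
    the norm of the datum. Frequency 0, which would be counted twice, contributes nothing. *)
Lemma leaf_amp_sum k : ((\sum_(j <- iota 0 k) leaf_amp j)%:E <= wnorm 0 0 zeta0)%E.
Proof.
rewrite wnorm00E.
case: k => [|k].
  by rewrite big_nil; apply: esum_ge0 => n _; rewrite lee_fin fourier_abs_ge0.
rewrite /= big_cons leaf_amp_zero add0r.
pose s := [seq j%:Z | j <- iota 1 k] ++ [seq - j%:Z | j <- iota 1 k].
have us : uniq s.
  have u1 : uniq [seq j%:Z | j <- iota 1 k] by rewrite map_inj_uniq ?iota_uniq// => i j [].
  have u2 : uniq [seq - j%:Z | j <- iota 1 k].
    by rewrite map_inj_uniq ?iota_uniq// => i j /oppr_inj [].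
  rewrite cat_uniq u1 u2 andbT; apply/hasPn => x /mapP[i].
  rewrite mem_iota => /andP[i1 _] ->; apply/mapP => -[j _].
  by case: i i1.
apply: esum_ge; exists [set` s]; first by split => //; exact: finite_seq.
rewrite -fsbig_seq// sumEFin lee_fin big_cat /= !big_map -big_split /=.
by apply: ler_sum => j _; rewrite fourier_absN// /leaf_amp mulr_natl mulr2n.
Qed.

End initial_data.

(** * Derivatives of periodic functions *)

Section periodic.
Context {R : realType}.

Lemma derive1_is_derive (f : R -> R) (x : R) : derivable f x 1 ->
  is_derive x 1 f (derive1 f x).
Proof. by move=> df; rewrite derive1E; exact: derivableP. Qed.

Lemma derivable_continuous (f : R -> R) : (forall x : R, derivable f x 1) -> continuous f.
Proof. by move=> df; apply: is_derive_continuous => x; exact: derive1_is_derive. Qed.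

Lemma derive1_periodic (f : R -> R) : (forall x : R, derivable f x 1) ->
  (forall x, f (x + 2 * pi) = f x) -> forall x, derive1 f (x + 2 * pi) = derive1 f x.
Proof.
move=> df per x.
have h := derive1_is_derive (df (1 * x + 2 * pi)).
have := isd_lin h; rewrite !mul1r.
have -> : (fun y => f (1 * y + 2 * pi)) = f by apply/funext => y; rewrite mul1r per.
by move=> h'; rewrite [RHS]derive1E derive_val.
Qed.

End periodic.

(** * Assembly of the global solution *)

Theorem theorem4p2 (R : realType) (eps Bo : R) (zeta0 : R -> R) :
  0 < eps <= 1 -> 0 < Bo < 1 ->
  wiener 0 0 zeta0 ->
  intT zeta0 = 0 ->
  (wnorm 0 0 zeta0 < ((Bo^-1 - 1) / (8 * eps * (Bo^-1 + 1)))%:E)%E ->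
  exists zeta : R -> R -> R,
    (forall T : R, 0 < T -> weak_solution eps Bo T zeta0 zeta) /\
    (forall nu : R, 0 <= nu < (Bo^-1 - 1) / 2 -> forall T : R, 0 < T ->
      ((exists M : R, forall t, t \in `[0%R, T] ->
          (wnorm 0 (nu * t) (zeta t) <= M%:E)%E) /\
       (\int[@lebesgue_measure R]_(t in `[0%R, T]) wnorm 4 (nu * t) (zeta t)
          < +oo)%E) /\
      (forall t, t \in `[0%R, T] ->
        (wnorm 0 (nu * t) (zeta t)
           + ((Bo^-1 - 1) / 64)%:E
             * \int[@lebesgue_measure R]_(t' in `[0%R, t]) wnorm 4 (nu * t') (zeta t')
           <= wnorm 0 0 zeta0)%E /\
        (wnorm 0 (nu * t) (zeta t)
           <= wnorm 0 0 zeta0 * (expR (- (t / 64) * (Bo^-1 - 1)))%:E)%E)).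
Proof.
move=> /andP[eps0 _] /andP[Bo0 Bo1] [zL zfin] zmean zsmall.
set beta := Bo^-1 in zsmall *.
have beta1 : 1 < beta by rewrite invf_gt1.
have [z0 zE] : exists z0, wnorm 0 0 zeta0 = z0%:E.
  exists (fine (wnorm 0 0 zeta0)); rewrite fineK// ge0_fin_numE//; exact: wnorm_ge0.
rewrite zE in zsmall *.
have rho_ge0 := leaf_amp_ge0 zeta0.
have rho_zero := leaf_amp_zero zmean.
have rho_sum k : \sum_(j <- iota 0 k) leaf_amp zeta0 j <= z0.
  by rewrite -lee_fin -zE; exact: leaf_amp_sum.
have small : 8 * eps * (beta + 1) * z0 <= beta - 1.
  move: zsmall; rewrite lte_fin ltr_pdivlMr; last by rewrite !mulr_gt0//; lra.
  by move=> /ltW; rewrite mulrC.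
have [theta thetaP] := leaf_amp_phase zeta0.
pose zeta := zlim eps beta (leaf_amp zeta0) theta.
exists (zeta 0%N); split; last first.
  move=> nu /andP[nu0 nub] T T0.
  have nubb : 0 <= nu <= (beta - 1) / 2 by rewrite nu0 ltW.
  split; last first.
    move=> t; rewrite in_itv /= => /andP[t0 _]; split.
      by case: (energy theta rho_ge0 rho_zero eps0 beta1 rho_sum small nubb t0).
    exact: decay.
  split; last by case: (energy theta rho_ge0 rho_zero eps0 beta1 rho_sum small nubb (ltW T0)).
  exists z0 => t; rewrite in_itv /= => /andP[t0 _].
  have [E _] := energy theta rho_ge0 rho_zero eps0 beta1 rho_sum small nubb t0.
  apply: le_trans E; rewrite leeDl// mule_ge0//; first by rewrite lee_fin; lra.
  by apply: integral_ge0 => s _; exact: wnorm_ge0.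
move=> T T0; split; first exact: jmeas_zlim.
split.
  exists z0; apply: aeW => t _; apply: aeW => x _.
  exact: zlim0_norm_leT.
exists (zeta 1%N), (zeta 2%N), (zeta 3%N); split; first by split; exact: jmeas_zlim.
(* The only exceptional time is [t = 0], where the weak derivatives were set to zero by the cut. *)
have ae0 (P : R -> Prop) : (forall t, 0 < t -> P t) ->
    {ae (@lebesgue_measure R), forall t, t \in `[0%R, T] -> P t}.
  move=> h; exists [set 0]; split => //; first exact: lebesgue_measure_set1.
  move=> t /= nh; apply: contrapT => t0; apply: nh; rewrite in_itv /= => /andP[t1 _].
  by apply: h; rewrite lt_def t1 andbT; exact/eqP.
split.
  apply: ae0 => t t0 psi [dpsi per].
  have dn n (x : R) : is_derive x 1 (iter n (@derive1 R R) psi) (iter n.+1 (@derive1 R R) psi x).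
    exact: derive1_is_derive.
  have cn n : continuous (iter n (@derive1 R R) psi) by exact: derivable_continuous.
  have pn n x : iter n (@derive1 R R) psi (x + 2 * pi) = iter n (@derive1 R R) psi x.
    by elim: n x => [|n ih] x; [exact: per|exact: derive1_periodic].
  have wd i n : (i < 4)%N -> intT (fun x => zeta i t x * iter n.+1 (@derive1 R R) psi x) =
      - intT (fun x => zeta i.+1 t x * iter n (@derive1 R R) psi x).
    move=> i4; exact: (@weak_derivative R eps beta z0 (leaf_amp zeta0) theta rho_ge0 rho_zero
      eps0 beta1 rho_sum small i _ _ t i4 t0 (dn n) (cn n.+1) (pn n)).
  by split; [exact: (wd 0 0)|rewrite (wd 0 1)// (wd 1 0)// opprK
    |rewrite (wd 0 2)// (wd 1 1)// (wd 2 0)// opprK].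
split.
  (* Four terms, each at most [gmaj] by [zlim_norm_le]. *)
  exists (fun t => 4 * gmaj eps beta (leaf_amp zeta0) t); split.
    have ig := integrable_gmaj rho_ge0 rho_zero eps0 beta1 rho_sum small (ltW T0).
    have mT : measurable (`[0, T]%classic : set R) by exact: measurable_itv.
    by have := @integrableZl _ _ _ (@lebesgue_measure R) _ mT 4 _ ig; apply.
  apply: ae0 => t t0; apply: aeW => x _.
  have b i : (i <= 4)%N -> `|zeta i t x| <= gmaj eps beta (leaf_amp zeta0) t.
    by move=> i4; exact: (zlim_norm_le theta rho_ge0 rho_zero eps0 beta1 rho_sum small x i4 t0).
  have := b 0 isT; have := b 1 isT; have := b 2 isT; have := b 3 isT; lra.
move=> phi [dphi per] t; rewrite in_itv /= => /andP[t0 _].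
have [c0 d0] := dphi [::]; have [c1 _] := dphi [:: true]; have [c2 _] := dphi [:: false].
have dt_ (s x : R) : is_derive s 1 (phi ^~ x) (dt phi s x).
  by apply: derive1_is_derive; have [] := d0 s x.
have dx_ (s x : R) : is_derive x 1 (phi s) (dx phi s x).
  by apply: derive1_is_derive; have [] := d0 s x.
(* Datum and limit at time zero have the same Fourier coefficients by the choice of amplitudes and
   phases, so they pair equally with the smooth function [phi 0]. *)
have -> : intT (fun x => zeta0 x * phi 0 x) = intT (fun x => zeta 0%N 0 x * phi 0 x).
  have zL0 : L1T (zeta 0%N 0).
    apply: (@le_integrable _ _ _ (@lebesgue_measure R) _ (@measurable_torus R) _ (EFin \o cst z0)).
    - apply/measurable_EFinP.
      by apply: measurable_section; [exact: jmeas_zlim|exact: measurable_torus].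
    - move=> x _; rewrite lee_fin (le_trans _ (ler_norm _))//.
      exact: (zlim0_norm_leT theta rho_ge0 rho_zero eps0 beta1 rho_sum small).
    - exact: torus_cst_integrable.
  apply: (eq_fourier_intT zL zL0 _ (dx_ 0) _ (per 0)).
    move=> q; have [-> ->] := thetaP q; rewrite /zeta.
    by rewrite (fourier_re_zlim0 theta rho_ge0 rho_zero eps0 beta1 rho_sum small)
      (fourier_im_zlim0 theta rho_ge0 rho_zero eps0 beta1 rho_sum small).
  exact: (@continuous_section2 R (dx phi) 0 c2).
exact: (weak_limit theta rho_ge0 rho_zero eps0 beta1 rho_sum small c0 c1 c2 dt_ dx_ per t0).
Qed.
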